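(* Let $r\ge1$ and $\mathcal{C}=\{1,2,\dots,r\}$. For each $u\in\mathcal{C}$ let $\{d_{u,n}\}_{n\ge1}$ and $\{b_{u,n}\}_{n\ge1}$ be real random variables, let $\alpha_u>0$, and suppose that there is a real sequence $\{m_{u,k}\}_{k\ge0}$ with $m_{u,0}=1$ such that $$\lim_{n\to\infty}\mathbb{E}\left[(b_{u,n}/n^{\alpha_u})^k\right]=m_{u,k}\quad\text{and}\quad\sup_{n\ge1}\mathbb{E}\left[|d_{u,n}|^k\right]<\infty\qquad\text{for every integer }k\ge0.$$ Assume that all the random variables $d_{u,n},b_{u,n}$ ($u\in\mathcal{C}$, $n\ge1$) are independent of one another. Let $A_{u,n}$ be the symmetric tridiagonal matrix built from $\{d_{u,n}\},\{b_{u,n}\}$ as in the context, and $X_{u,n}=n^{-\alpha_u}A_{u,n}$. Then for every $k\ge1$ and every $\mathbf{c}=(i_1,i_2,\dots,i_k)\in\mathcal{C}^k$, $$\lim_{n\to\infty}\mathrm{tr}_n(X_{i_1,n}X_{i_2,n}\cdots X_{i_k,n})=\frac{1}{\alpha_{i_1}+\alpha_{i_2}+\dots+\alpha_{i_k}+1}\sum_{\gamma\in\Gamma_k^{\mathbf{c}}}\ \prod_{u\in\mathcal{C}}\ \prod_{i\in\mathbb{Z}}m_{u,\mathbbm{l}_i^{u}(\gamma)},$$ where the limit holds both in the sense that the expectations of the left-hand traces converge to the right-hand side and in the almost sure sense.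
   Context: Matrix model: $A_{u,n}$ is the $n\times n$ symmetric tridiagonal matrix whose diagonal entries, from top to bottom, are $d_{u,n},d_{u,n-1},\dots,d_{u,1}$ and whose off-diagonal entries, from top to bottom, are $b_{u,n-1},\dots,b_{u,1}$; all other entries are $0$. All moments of the variables are understood to be finite, and all variables live on one probability space. $\mathrm{tr}_n(Y)=\frac1n\sum_{i=1}^n y_{i,i}$. Colored paths: $\Gamma_k$ is the set of $\gamma=(j_1,\dots,j_{k+1})\in\mathbb{Z}^{k+1}$ with $j_1=j_{k+1}$, $|j_t-j_{t+1}|=1$ for $1\le t\le k$, and $\max_t j_t=0$ (it is empty for $k$ odd). For $\mathbf{c}=(i_1,\dots,i_k)\in\mathcal{C}^k$, $\Gamma_k^{\mathbf{c}}$ is the set of paths $\gamma\in\Gamma_k$ with, for each $t$, the step $(j_t,j_{t+1})$ colored with color $i_t$. For $\gamma\in\Gamma_k^{\mathbf{c}}$, $u\in\mathcal{C}$ and $i\in\mathbb{Z}$, $\mathbbm{l}_i^{u}(\gamma)$ is the number of crossings of the line $y=i+1/2$ by steps of color $u$, i.e. the number of $t\in\{1,\dots,k\}$ with $i_t=u$ and $\{j_t,j_{t+1}\}=\{i,i+1\}$. *)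

(* Defs.v *)
From HB Require Import structures.
From mathcomp Require Import all_boot all_order all_algebra finmap.
From mathcomp Require Import all_classical all_reals all_analysis.

Set Implicit Arguments.
Unset Strict Implicit.
Unset Printing Implicit Defensive.

Import Order.TTheory GRing.Theory Num.Theory.
Import numFieldNormedType.Exports.

Local Open Scope classical_set_scope.
Local Open Scope ring_scope.

Definition finite_moments (d : measure_display) (T : measurableType d)
    (R : realType) (P : probability T R) (X : {RV P >-> R}) : Prop :=
  forall k : nat, P.-integrable [set: T] (fun w => (X w ^+ k)%:E).

(* Mutual independence of the subfamily indexed by D: the product rule holds
   for every finite subset of D. *)
Definition independent_RVs (d : measure_display) (T : measurableType d)
    (R : realType) (P : probability T R) (I : choiceType) (D : set I)
    (X : I -> {RV P >-> R}) : Prop :=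
  forall (J : {fset I}) (B : I -> set R),
    [set` J] `<=` D ->
    (forall i, i \in J -> measurable (B i)) ->
    P (\bigcap_(i in [set` J]) (X i @^-1` B i)) =
      (\prod_(i <- J) P (X i @^-1` B i))%E.

(* inl (u, n) and inr (u, n) index the diagonal variable d_{u,n} and the
   off-diagonal variable b_{u,n}. *)
Definition entries (A C : Type) (d b : C -> nat -> A)
    (x : (C * nat) + (C * nat)) : A :=
  match x with inl un => d un.1 un.2 | inr un => b un.1 un.2 end.

(* Sequences start at index 1; their value at 0 is ignored. *)
Definition entries_index (C : Type) : set ((C * nat) + (C * nat)) :=
  [set x | match x with inl un => 0 < un.2 | inr un => 0 < un.2 end]%N.

(* Rows and columns are numbered from 0, so the diagonal entry of row i is
   d_{n-i} and the entries at (i, i+1) and (i+1, i) are b_{n-(i+1)}. *)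
Definition tridiag (R : nzRingType) (d b : nat -> R) (n : nat) : 'M[R]_n :=
  \matrix_(i < n, j < n)
    if i == j then d (n - i)%N
    else if j == i.+1 :> nat then b (n - j)%N
    else if i == j.+1 :> nat then b (n - i)%N
    else 0.

Definition normalized_tridiag (R : realType) (alpha : R) (d b : nat -> R)
    (n : nat) : 'M[R]_n :=
  (n%:R `^ (- alpha)) *: tridiag d b n.

Definition ntr (R : fieldType) (n : nat) (Y : 'M[R]_n) : R := n%:R^-1 * \tr Y.

(* With indices shifted by one, gamma`_t is the height j_{t+1}. *)
Definition Gamma (k : nat) : set (k.+1.-tuple int) :=
  [set gamma | [/\ gamma`_0 = gamma`_k,
    forall t : nat, (t < k)%N -> `|gamma`_t - gamma`_t.+1| = 1 &
    \big[Order.max/gamma`_0]_(j <- gamma) j = 0]].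

Arguments Gamma : clear implicits.

(* The coloring c determines the colors of all the steps, so a path of
   Gamma_k^c is encoded as a path of Gamma_k, and c is an argument here. *)
Definition crossings (C : eqType) (k : nat) (c : k.-tuple C) (u : C) (i : int)
    (gamma : k.+1.-tuple int) : nat :=
  #|[pred t : 'I_k | (tnth c t == u) &&
      ([fset gamma`_t; gamma`_t.+1]%fset == [fset i; (i + 1)%R]%fset)]|.

(* Main.v *)
Require Import Defs.
From HB Require Import structures.
From mathcomp Require Import all_boot all_order all_algebra finmap.
From mathcomp Require Import all_classical all_reals all_analysis.
From mathcomp Require Import measurable_realfun.
From mathcomp Require Import ring lra zify.

Set Implicit Arguments.
Unset Strict Implicit.
Unset Printing Implicit Defensive.

Import Order.TTheory GRing.Theory Num.Theory.
Import numFieldNormedType.Exports.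

Local Open Scope classical_set_scope.
Local Open Scope ring_scope.

(** The trace of a product of k tridiagonal matrices of size n is a sum over the
    closed walks of k+1 row indices whose steps are -1, 0 or 1.  Such a walk is
    its smallest row index p together with its shape, the tuple h of the depths
    below p: h is closed, has steps -1, 0 or 1 and takes the value 0, so that
    for fixed k there are finitely many shapes.  The entries met by the walk are the
    variables of index N - delta, where N = n - p and delta is the larger depth
    at the two ends of a step.  Hence the product W_h(N) of these entries does
    not depend on n, and with A = alpha_{i_1} + ... + alpha_{i_k} and
    Y_h(N) = N^{-A} W_h(N), or 0 for the few N for which the walk would leave
    the matrix, the normalized trace is
      n^{-1-A} sum_h sum_{N <= n} N^A Y_h(N)
    ([ntr_prod_normalized_tridiag]).

    Fix a shape h.  Grouping equal variables in W_h(N), independence makes its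
    expectation a product of moments of single entries ([Rintegral_monomial]).
    After division by powers of N, the moments of the off-diagonal entries tend
    to the numbers m, while those of the diagonal entries vanish because they
    are bounded.  So the expectation of Y_h(N) tends to a limit w_h
    ([cvg_normalized_weight]), which is zero as soon as h has a zero step.  A
    shape with nonzero steps is the opposite of a path of Gamma_k, and its steps
    with larger depth delta are the crossings of the line at height
    1/2 - delta; hence the sum of the w_h is the sum over Gamma_k
    ([sum_Gamma]).

    Applied to W_h(N)^2, the same argument bounds the second moments of the
    Y_h(N).  Moreover W_h(N) and W_h(N') share no variable once N and N' differ
    by more than k, and are then uncorrelated.  These two facts suffice for a
    strong law of large numbers ([strong_law], through variance bounds along
    the squares): almost surely, the means of the Y_h(N) over N <= n converge to
    w_h.  The same holds for the means of the expectations, by Cesaro.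

    It remains to insert the weights N^A: if the means of a sequence y converge
    to L, then n^{-1-A} sum_{N <= n} N^A y_N converges to L / (A + 1)
    ([cvg_weighted_mean]).  This deterministic statement gives both the
    convergence of the expectations and the almost sure convergence. *)

(** * Products of independent random variables *)

Section ProductOfIndependent.
Context (disp : measure_display) (T : measurableType disp) (R : realType)
  (P : probability T R).
Local Open Scope ereal_scope.
Import HBNNSimple.

(** Both sides are continuous along increasing sequences in f, so the case of
    indicators extends to simple functions and then to all nonnegative f.  This
    replaces one indicator of an independent variable by a function of it. *)
Lemma integralM_comp_of_indic (X G : T -> R) (c : R) (f : R -> R) :
  measurable_fun setT X -> measurable_fun setT G -> (forall w, (0 <= G w)%R) ->
  (forall B : set R, measurable B ->
    \int[P]_w (G w * \1_B (X w))%:E = c%:E * P (X @^-1` B)) ->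
  measurable_fun setT f -> (forall x, (0 <= f x)%R) ->
  \int[P]_w (G w * f (X w))%:E = c%:E * \int[P]_w (f (X w))%:E.
Proof.
move=> mX mG G0 HB mf f0.
have mEf : measurable_fun setT (EFin \o f) by exact/measurable_EFinP.
pose f_ := nnsfun_approx measurableT mEf.
have f_cvg x : (f_ n x)%:E @[n --> \oo] --> (f x)%:E.
  by apply: cvg_nnsfun_approx => // y _; rewrite lee_fin.
have f_nd x : {homo (fun n => f_ n x) : m n / (m <= n)%N >-> (m <= n)%R}.
  by move=> m n mn; exact/lefP/nd_nnsfun_approx.
have mfX n : measurable_fun setT (fun w => (f_ n (X w))%:E).
  by apply/measurable_EFinP; apply: measurableT_comp.
have mEG : measurable_fun setT (EFin \o G) by exact/measurable_EFinP.
have G0e w : 0 <= (G w)%:E by rewrite lee_fin.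
(* The identity for simple functions, by linearity from the hypothesis. *)
have simple n : \int[P]_w ((G w)%:E * (f_ n (X w))%:E) =
    c%:E * \int[P]_w (f_ n (X w))%:E.
  have ge0 r x : 0 <= (r * \1_(f_ n @^-1` [set r]) x)%:E.
    by rewrite nnfun_muleindic_ge0.
  have mI r : measurable_fun setT
      (fun w => (\1_(f_ n @^-1` [set r]) (X w) : R)).
    apply: (@measurableT_comp _ _ _ _ _ _
      (\1_(f_ n @^-1` [set r]) : R -> R)) => //.
  have mrI r : measurable_fun setT
      (fun w => (r * \1_(f_ n @^-1` [set r]) (X w))%:E).
    by apply/measurable_EFinP; exact: measurable_funM.
  have E w : (f_ n (X w))%:E =
      \sum_(r \in range (f_ n)) (r * \1_(f_ n @^-1` [set r]) (X w))%:E.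
    by rewrite fimfunE -fsumEFin.
  under eq_integral do rewrite E.
  under eq_integral do rewrite ge0_mule_fsumr//.
  rewrite ge0_integral_fsum//=; last 2 first.
  - by move=> r; exact: emeasurable_funM.
  - by move=> r w _; rewrite mule_ge0.
  under [in RHS]eq_integral do rewrite E.
  rewrite [in RHS]ge0_integral_fsum//= ge0_mule_fsumr; last first.
    by move=> r; apply: integral_ge0.
  apply: eq_fsbigr => r rf.
  have r0 : (0 <= r)%R by move: rf; rewrite inE => -[x _ <-].
  transitivity (r%:E * \int[P]_w (G w * \1_(f_ n @^-1` [set r]) (X w))%:E).
    rewrite -ge0_integralZl_EFin//; last 2 first.
    - by move=> w _; rewrite lee_fin mulr_ge0.
    - by apply/measurable_EFinP; exact: measurable_funM.
    by apply: eq_integral => w _; rewrite -!EFinM mulrCA.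
  rewrite HB// muleCA; congr (_ * _).
  under eq_integral do rewrite EFinM.
  rewrite ge0_integralZl_EFin//; last exact/measurable_EFinP.
  congr (_ * _).
  rewrite -[X in P X]setIT -(@integral_indic _ _ _ P setT)//.
  by rewrite -[X in measurable X]setTI; exact: mX.
transitivity (limn (fun n => \int[P]_w ((G w)%:E * (f_ n (X w))%:E))).
  rewrite -monotone_convergence//.
  - apply: eq_integral => w _; apply/esym/cvg_lim => //.
    by rewrite EFinM; apply: cvgeZl.
  - by move=> n; exact: emeasurable_funM.
  - by move=> n w _; rewrite mule_ge0// lee_fin.
  - by move=> w _ m n mn; apply: lee_wpmul2l => //; rewrite lee_fin f_nd.
under eq_fun do rewrite simple.
apply/cvg_lim => //; apply: cvgeZl => //.
have -> : \int[P]_w (f (X w))%:E = \int[P]_w limn (fun n => (f_ n (X w))%:E).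
  by apply: eq_integral => w _; apply/esym/cvg_lim.
apply: cvg_monotone_convergence => //.
- by move=> n w _; rewrite lee_fin.
- by move=> w _ m n mn; rewrite lee_fin f_nd.
Qed.

End ProductOfIndependent.

Section Independent.
Context (disp : measure_display) (T : measurableType disp) (R : realType)
  (P : probability T R) (I : choiceType) (D : set I) (V : I -> {RV P >-> R}).
Hypothesis indep : independent_RVs D V.

Lemma EFin_Rintegral (f : T -> R) : P.-integrable setT (EFin \o f) ->
  (\int[P]_w (f w)%:E)%E = (\int[P]_w f w)%:E.
Proof. by move=> fi; rewrite fineK//; exact: integrable_fin_num. Qed.

Lemma measurable_comp_RV (g : R -> R) (i : I) : measurable_fun setT g ->
  measurable_fun setT (fun w => g (V i w)).
Proof. by move=> mg; apply: measurableT_comp. Qed.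

(** The independence hypothesis is the case without functions.  The indicators
    are turned into functions one variable at a time: for fixed other factors,
    the integral is a multiple of the law of the remaining variable. *)
Lemma ge0_integral_prod_indic (g : I -> R -> R) :
  (forall i, measurable_fun setT (g i)) -> (forall i x, 0 <= g i x) ->
  forall (s s' : seq I) (B : I -> set R),
  (forall i, i \in s -> P.-integrable setT (fun w => (g i (V i w))%:E)) ->
  (forall i, measurable (B i)) -> uniq (s ++ s') -> [set` s ++ s'] `<=` D ->
  (\int[P]_w (\prod_(i <- s) g i (V i w) *
              \prod_(i <- s') \1_(B i) (V i w))%:E)%E =
  (\prod_(i <- s) (\int[P]_w g i (V i w)) *
   \prod_(i <- s') fine (P (V i @^-1` B i)))%:E.
Proof.
move=> mg g0; elim=> [|i s IH] s' B gi mB us sD.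
  rewrite big_nil mul1r.
  under eq_integral do rewrite big_nil mul1r.
  have mVB i : measurable (V i @^-1` B i).
    by rewrite -[X in measurable X]setTI; exact: measurable_funP.
  have -> : (\prod_(i <- s') fine (P (V i @^-1` B i)))%:E =
      (\prod_(i <- s') P (V i @^-1` B i))%E.
    elim: s' {us sD} => [|j s' IH]; first by rewrite !big_nil.
    by rewrite !big_cons EFinM IH fineK// fin_num_measure.
  have := indep (J := [fset x in s']%fset) (B := B) _ (fun i _ => mB i).
  have -> : (\prod_(i <- [fset x in s']%fset) P (V i @^-1` B i) =
      \prod_(i <- s') P (V i @^-1` B i))%E.
    by apply: perm_big; apply: uniq_perm => // i; rewrite inE.
  move=> <-; last by move=> i /=; rewrite inE => si; apply: sD.
  rewrite -[X in P X]setIT -(@integral_indic _ _ _ P setT)//; last first.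
    by apply: fin_bigcap_measurable.
  apply: eq_integral => w _; congr (_%:E); rewrite indicE.
  rewrite (_ : _ \in _ = all (fun i => V i w \in B i) s').
    elim: s' {us sD} => [|j s' IH]; first by rewrite big_nil.
    by rewrite big_cons IH indicE /= -natrM mulnb.
  apply/idP/allP => [/[!inE] H i si|H]; rewrite inE.
    by apply: H; rewrite /= inE.
  by move=> i /=; rewrite inE => /H; rewrite inE.
have [is_ us'] : i \notin s ++ s' /\ uniq (s ++ s').
  by move: us => /= /andP[].
have iD : D i by apply: sD; rewrite /= inE eqxx.
have [iNs iNs'] : i \notin s /\ i \notin s'.
  by apply/andP; rewrite -negb_or -mem_cat.
under eq_integral do rewrite big_cons -mulrA mulrC.
rewrite (@integralM_comp_of_indic _ _ _ P (V i)
  (fun w => \prod_(j <- s) g j (V j w) * \prod_(j <- s') \1_(B j) (V j w))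
  (\prod_(j <- s) (\int[P]_w g j (V j w)) *
   \prod_(j <- s') fine (P (V j @^-1` B j))))//.
- rewrite EFin_Rintegral; last by apply: gi; rewrite inE eqxx.
  by rewrite -EFinM big_cons -mulrA mulrC.
- apply: measurable_funM; apply: measurable_prod => j _.
    exact: measurable_comp_RV.
  exact: (measurable_comp_RV (g := \1_(B j))).
- by move=> w; rewrite mulr_ge0// prodr_ge0.
move=> A mA.
pose B' j := if j == i then A else B j.
have B'E : {in s', B' =1 B}.
  by move=> j js; rewrite /B'; case: eqP => // ji; rewrite -ji js in iNs'.
have B'i : B' i = A by rewrite /B' eqxx.
have EB (F : I -> set R -> R) :
    \prod_(j <- i :: s') F j (B' j) = F i A * \prod_(j <- s') F j (B j).
  by rewrite big_cons B'i; congr (_ * _); apply: eq_big_seq => j js; rewrite B'E.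
transitivity (\int[P]_w (\prod_(j <- s) g j (V j w) *
    \prod_(j <- i :: s') \1_(B' j) (V j w))%:E)%E.
  apply: eq_integral => w _.
  by rewrite (EB (fun j b => \1_b (V j w))) /= -mulrA [X in _ * X]mulrC.
rewrite IH ?(EB (fun j b => fine (P (V j @^-1` b)))).
- rewrite -[P (V i @^-1` A)]fineK; last first.
    by rewrite fin_num_measure// -[X in measurable X]setTI;
      exact: measurable_funP.
  by rewrite -EFinM mulrCA mulrC.
- by move=> j js; apply: gi; rewrite inE js orbT.
- by move=> j; rewrite /B'; case: ifP.
- by rewrite -[i :: s']cat1s uniq_catCA.
- move=> j /=; rewrite mem_cat inE => js; apply: sD => /=.
  by rewrite inE mem_cat orbCA.
Qed.

Lemma ge0_integral_prod (g : I -> R -> R) (Q : seq I) :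
  (forall i, measurable_fun setT (g i)) -> (forall i x, 0 <= g i x) ->
  (forall i, i \in Q -> P.-integrable setT (fun w => (g i (V i w))%:E)) ->
  uniq Q -> [set` Q] `<=` D ->
  (\int[P]_w (\prod_(i <- Q) g i (V i w))%:E)%E =
  (\prod_(i <- Q) (\int[P]_w g i (V i w)))%:E.
Proof.
move=> mg g0 gi uQ QD.
have := @ge0_integral_prod_indic g mg g0 Q [::] (fun=> setT) gi.
rewrite cats0 big_nil mulr1 => <- //.
by apply: eq_integral => w _; rewrite big_nil mulr1.
Qed.

Lemma integrable_prod (g : I -> R -> R) (Q : seq I) :
  (forall i, measurable_fun setT (g i)) ->
  (forall i, i \in Q -> P.-integrable setT (fun w => (g i (V i w))%:E)) ->
  uniq Q -> [set` Q] `<=` D ->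
  P.-integrable setT (fun w => (\prod_(i <- Q) g i (V i w))%:E).
Proof.
move=> mg gi uQ QD; apply/integrableP; split.
  apply/measurable_EFinP; apply: measurable_prod => i _.
  exact: measurable_comp_RV.
under eq_integral do rewrite /= normr_prod.
rewrite (ge0_integral_prod (g := fun i x => `|g i x|)) ?ltry//.
- by move=> i; apply: measurableT_comp.
- by move=> i /gi; exact: integrable_norm.
Qed.

(** Expanding one factor as the difference of its positive and negative parts
    leaves one signed factor less, which reduces to the nonnegative case. *)
Lemma Rintegral_prod (g : I -> R -> R) (Q : seq I) :
  (forall i, measurable_fun setT (g i)) ->
  (forall i, i \in Q -> P.-integrable setT (fun w => (g i (V i w))%:E)) ->
  uniq Q -> [set` Q] `<=` D ->
  \int[P]_w (\prod_(i <- Q) g i (V i w)) =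
  \prod_(i <- Q) (\int[P]_w g i (V i w)).
Proof.
move=> + + uQ QD.
(* S lists the variables whose factor may still change sign. *)
suff H (S : seq I) : {subset S <= Q} -> forall g : I -> R -> R,
    (forall i, measurable_fun setT (g i)) ->
    (forall i, i \in Q -> P.-integrable setT (fun w => (g i (V i w))%:E)) ->
    (forall i, i \in Q -> i \notin S -> forall x, 0 <= g i x) ->
    \int[P]_w (\prod_(i <- Q) g i (V i w)) =
    \prod_(i <- Q) (\int[P]_w g i (V i w)).
  by move=> mg gi; apply: (H Q) => // i ->.
elim: S => [|i S IH] SQ {}g mg gi g0.
  have gE i x : i \in Q -> g i x = `|g i x| by move=> iQ; rewrite ger0_norm ?g0.
  transitivity (\int[P]_w \prod_(i <- Q) `|g i (V i w)|).
    by apply: eq_Rintegral => w _; apply: eq_big_seq => i /gE.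
  transitivity (\prod_(i <- Q) \int[P]_w `|g i (V i w)|); last first.
    by apply: eq_big_seq => i iQ; apply: eq_Rintegral => w _; rewrite -gE.
  rewrite /Rintegral (ge0_integral_prod (g := fun i x => `|g i x|))//.
    by move=> i; apply: measurableT_comp.
  by move=> i /gi; exact: integrable_norm.
have iQ : i \in Q by apply: SQ; rewrite inE eqxx.
(* The family g with its factor at i replaced by h (g i), where h is the
   positive or the negative part. *)
pose upd h := fun j => if j == i then h (g i) else g j.
have upd_prod h (F : I -> (R -> R) -> R) : \prod_(j <- Q) F j (upd h j) =
    F i (h (g i)) * \prod_(j <- rem i Q) F j (g j).
  rewrite (perm_big _ (perm_to_rem iQ))/= big_cons /upd eqxx; congr (_ * _).
  apply: eq_big_seq => j; rewrite mem_rem_uniq// inE => /andP[/negbTE ji _].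
  by rewrite ji.
have key (h : (R -> R) -> R -> R) :
    (forall f, measurable_fun setT f -> measurable_fun setT (h f)) ->
    (forall f x, 0 <= h f x <= `|f x|) ->
  [/\ P.-integrable setT (fun w => (h (g i) (V i w))%:E),
      P.-integrable setT (fun w => (\prod_(j <- Q) upd h j (V j w))%:E) &
      \int[P]_w (\prod_(j <- Q) upd h j (V j w)) =
      \prod_(j <- Q) (\int[P]_w upd h j (V j w))].
  move=> mh h0.
  have mupd j : measurable_fun setT (upd h j).
    by rewrite /upd; case: ifP => // _; exact: mh.
  have hi : P.-integrable setT (fun w => (h (g i) (V i w))%:E).
    apply: (le_integrable _ _ _ (gi _ iQ)) => //.
      by apply/measurable_EFinP/measurable_comp_RV; exact: mh.
    by move=> w _ /=; rewrite lee_fin; case/andP: (h0 (g i) (V i w)) => /ger0_norm->.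
  have iupd j : j \in Q -> P.-integrable setT (fun w => (upd h j (V j w))%:E).
    by rewrite /upd; case: ifP => [/eqP->//|_]; exact: gi.
  split=> //; first exact: integrable_prod.
  apply: IH => // [j jS|j jQ jS x].
    by apply: SQ; rewrite inE jS orbT.
  rewrite /upd; case: ifP => [_|/negbT ji]; first by case/andP: (h0 (g i) x).
  by apply: g0 => //; rewrite inE negb_or ji.
have [||posi ipos Epos] := key (fun f x => Num.max (f x) 0).
- by move=> f mf; apply: measurable_maxr.
- by move=> f x; rewrite le_max lexx orbT ge_max ler_norm normr_ge0.
have [||negi ineg Eneg] := key (fun f x => Num.max (- f x) 0).
- by move=> f mf; apply: measurable_maxr => //; exact: measurableT_comp.
- by move=> f x; rewrite le_max lexx orbT ge_max -normrN ler_norm normr_ge0.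
have gE x : g i x = Num.max (g i x) 0 - Num.max (- g i x) 0.
  by case: (leP (g i x) 0); case: (leP (- g i x) 0); lra.
transitivity (\int[P]_w (\prod_(j <- Q) upd (fun f x => Num.max (f x) 0) j (V j w) -
    \prod_(j <- Q) upd (fun f x => Num.max (- f x) 0) j (V j w))).
  apply: eq_Rintegral => w _.
  rewrite !(upd_prod _ (fun j f => f (V j w))) -mulrBl -gE.
  by rewrite (perm_big _ (perm_to_rem iQ))/= big_cons.
rewrite RintegralB// Epos Eneg !(upd_prod _ (fun j f => \int[P]_w f (V j w))).
rewrite -mulrBl -RintegralB// (perm_big _ (perm_to_rem iQ))/= big_cons.
by congr (_ * _); apply: eq_Rintegral => w _; rewrite -gE.
Qed.
End Independent.

(** * Monomials in independent random variables *)

Lemma prod_count_exp (R : comNzRingType) (I : choiceType) (v : I -> R)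
    (s Q : seq I) : uniq Q -> {subset s <= Q} ->
  \prod_(x <- s) v x = \prod_(x <- Q) v x ^+ count_mem x s.
Proof.
move=> uQ; elim: s => [|y s IH] sQ.
  by rewrite big_nil big1.
rewrite big_cons IH; last by move=> x xs; apply: sQ; rewrite inE xs orbT.
under [RHS]eq_bigr do rewrite /= exprD.
rewrite big_split /=; congr (_ * _).
have yQ : y \in Q by apply: sQ; rewrite inE eqxx.
rewrite (perm_big _ (perm_to_rem yQ))/= big_cons eqxx expr1 big_seq big1 ?mulr1//.
by move=> x; rewrite mem_rem_uniq// inE eq_sym => /andP[/negbTE-> _].
Qed.

Lemma Rintegral_cst_probability (disp : measure_display)
    (T : measurableType disp) (R : realType) (P : probability T R) (c : R) :
  \int[P]_w c = c.
Proof. by rewrite /Rintegral integral_cst//= probability_setT mule1. Qed.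

Section Monomials.
Context (disp : measure_display) (T : measurableType disp) (R : realType)
  (P : probability T R) (I : choiceType) (D : set I) (V : I -> {RV P >-> R}).
Hypothesis indep : independent_RVs D V.
Hypothesis moments : forall i, D i -> finite_moments (V i).

Lemma integrable_monomial (s : seq I) : [set` s] `<=` D ->
  P.-integrable setT (fun w => (\prod_(x <- s) V x w)%:E).
Proof.
move=> sD; have sQ : {subset s <= undup s} by move=> x; rewrite mem_undup.
under eq_fun do rewrite (prod_count_exp _ (undup_uniq s) sQ).
apply: (integrable_prod indep (g := fun x r => r ^+ count_mem x s)).
- by move=> x; exact: exprn_measurable.
- by move=> x; rewrite mem_undup => xs; apply: moments; apply: sD.
- exact: undup_uniq.
- by move=> x /=; rewrite mem_undup => /sD.
Qed.

(** A variable met several times contributes a higher moment.  Allowing any Q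
    that contains s makes it possible to compare several monomials over the same
    list of variables, the absent ones contributing moments of order 0. *)
Lemma Rintegral_monomial (s Q : seq I) : uniq Q -> {subset s <= Q} ->
  [set` Q] `<=` D ->
  \int[P]_w (\prod_(x <- s) V x w) =
  \prod_(x <- Q) \int[P]_w (V x w ^+ count_mem x s).
Proof.
move=> uQ sQ QD; under eq_Rintegral do rewrite (prod_count_exp _ uQ sQ).
apply: (Rintegral_prod indep (g := fun x r => r ^+ count_mem x s)) => //.
- by move=> x xs; apply: moments; apply: QD.
Qed.

Lemma Rintegral_monomialM (s1 s2 : seq I) : [set` s1 ++ s2] `<=` D ->
  ~~ has (mem s1) s2 ->
  \int[P]_w (\prod_(x <- s1) V x w * \prod_(x <- s2) V x w) =
  \int[P]_w (\prod_(x <- s1) V x w) * \int[P]_w (\prod_(x <- s2) V x w).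
Proof.
move=> sD s12; pose Q := undup (s1 ++ s2).
have QD : [set` Q] `<=` D by move=> x /=; rewrite mem_undup => /sD.
have uQ : uniq Q := undup_uniq _.
under eq_Rintegral do rewrite -big_cat.
rewrite !(@Rintegral_monomial _ Q)//; first last.
- by move=> x xs; rewrite mem_undup mem_cat xs.
- by move=> x xs; rewrite mem_undup mem_cat xs orbT.
- by move=> x xs; rewrite mem_undup.
rewrite -big_split /=; apply: eq_bigr => x _; rewrite count_cat.
have E0 : \int[P]_w (V x w ^+ 0) = 1.
  by rewrite -[RHS](Rintegral_cst_probability P).
have [xs1|/count_memPn-> ] := boolP (x \in s1); last by rewrite E0 mul1r.
have /count_memPn -> : x \notin s2.
  by apply: contra s12 => xs2; apply/hasP; exists x.
by rewrite addn0 E0 mulr1.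
Qed.

End Monomials.

(** * Weighted means of real sequences *)

Section WeightedMean.
Context (R : realType).
Implicit Types (A L : R) (y : nat -> R).

(** Mean value theorem for the power of exponent A + 1. *)
Lemma powR_increment A (x : R) : 0 < A -> 1 <= x ->
  (A + 1) * x `^ A <= (x + 1) `^ (A + 1) - x `^ (A + 1) <=
  (A + 1) * (x + 1) `^ A.
Proof.
move=> A0 x1; have x0 : 0 < x by lra.
have dpow z : z \in `]x, (x + 1)[ ->
    is_derive z 1 (fun t => t `^ (A + 1)) ((A + 1) * z `^ A).
  rewrite in_itv /= => /andP[xz _].
  have := @is_derive1_powR R (A + 1) z (lt_trans x0 xz).
  by rewrite addrK.
have [||z] := MVT (_ : x < x + 1) dpow; first by rewrite ltrDl.
  apply: derivable_within_continuous => z; rewrite in_itv /= => /andP[xz _].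
  have z0 : 0 < z by lra.
  by have [] := is_derive1_powR (A + 1) z0.
rewrite in_itv /= => /andP[xz zx] ->.
rewrite (_ : x + 1 - x = 1) ?mulr1; last by ring.
have A1 : 0 < A + 1 by lra.
by rewrite !ler_pM2l// !ge0_ler_powR// ?nnegrE ?ltW//; lra.
Qed.

(** The sum of N ^ A compared with the integral of the same power. *)
Lemma sum_powR_bounds A (n : nat) : 0 < A ->
  n%:R `^ (A + 1) <= (A + 1) * \sum_(i < n) i.+1%:R `^ A <=
  n%:R `^ (A + 1) + (A + 1) * n%:R `^ A.
Proof.
move=> A0; elim: n => [|n IH].
  by rewrite big_ord0 mulr0 !powR0 ?mulr0 ?addr0 ?lexx//; lra.
rewrite big_ord_recr /= mulrDr.
(* The first term is apart: powR is differentiable only away from 0. *)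
case: n IH => [|n] IH.
  by rewrite big_ord0 mulr0 add0r !powR1; lra.
have := @powR_increment A n.+1%:R A0; rewrite ler1n => /(_ isT).
rewrite natr1 => /andP[h1 h2]; case/andP: IH => i1 i2.
by apply/andP; split; lra.
Qed.

Lemma cvg_sum_powR A : 0 < A ->
  n%:R^-1 * n%:R `^ (- A) * \sum_(i < n) i.+1%:R `^ A @[n --> \oo] -->
  (A + 1)^-1.
Proof.
move=> A0; have A1 : 0 < A + 1 by lra.
apply/cvgrPdist_le => e e0; near=> n.
have n0 : 0 < n%:R :> R by rewrite ltr0n; near: n; exists 1%N.
have nA : 0 < n%:R `^ A by rewrite powR_gt0.
have nA1 : n%:R `^ (A + 1) = n%:R `^ A * n%:R.
  by rewrite powRD ?powRr1 ?ltW// (gt_eqF n0) implybT.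
have /andP[] := sum_powR_bounds n A0; rewrite {}nA1.
set s := \sum_(i < n) _ => h1 h2.
rewrite powRN.
have -> : (A + 1)^-1 - n%:R^-1 * (n%:R `^ A)^-1 * s =
    ((n%:R `^ A * n%:R - (A + 1) * s) / n%:R `^ A / n%:R) / (A + 1).
  by field; rewrite !gt_eqF.
rewrite normrM normfV (gtr0_norm A1) ler_pdivrMr//.
rewrite normrM normfV normr_nat ler_pdivrMr//.
rewrite normrM normfV (gtr0_norm nA) ler_pdivrMr//.
have en : 1 <= e * n%:R.
  rewrite mulrC -ler_pdivrMr// mul1r; near: n; exact: nbhs_infty_ger.
rewrite ler0_norm; last lra.
have : (A + 1) * n%:R `^ A * 1 <= (A + 1) * n%:R `^ A * (e * n%:R).
  by rewrite ler_pM2l// mulr_gt0.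
lra.
Unshelve. all: by end_near. Qed.

(** Summation by parts expresses the weighted sum through the plain partial sums,
    which are what the hypothesis of [cvg_weighted_mean] controls. *)
Lemma sum_by_parts A y n :
  \sum_(i < n) i.+1%:R `^ A * y i = n%:R `^ A * (\sum_(i < n) y i) -
  \sum_(i < n) (i.+1%:R `^ A - i%:R `^ A) * (\sum_(j < i) y j).
Proof.
elim: n => [|n IH]; first by rewrite !big_ord0 mulr0 subr0.
by rewrite !big_ord_recr /= IH; ring.
Qed.

Lemma cvg_mean_affine_bound (s : nat -> R) : n%:R^-1 * s n @[n --> \oo] --> 0 ->
  forall e, 0 < e -> exists M, 0 <= M /\ forall n, `|s n| <= M + e * n%:R.
Proof.
move=> /cvgrPdist_le h e e0; have [N _ hN] := h e e0.
exists (`|s 0%N| + \sum_(i < N) `|s i|); split.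
  by rewrite addr_ge0// sumr_ge0.
move=> n; have [nN|Nn] := ltnP n N.
  rewrite (bigD1 (Ordinal nN))//= addrCA -addrA lerDl.
  by rewrite addr_ge0 ?addr_ge0 ?sumr_ge0// mulr_ge0// ltW.
case: n Nn => [|n] Nn; first by rewrite -addrA lerDl addr_ge0 ?sumr_ge0 ?mulr0.
have := hN n.+1 Nn; rewrite sub0r normrN normrM normfV normr_nat ler_pdivrMl//.
move=> le; apply: le_trans le _; rewrite mulrC lerDr.
by rewrite addr_ge0// sumr_ge0.
Qed.

(** After summation by parts, the increments of i ^ A are nonnegative and add up
    to n ^ A, while the partial sums of y are o(n). *)
Lemma cvg_weighted_mean0 A y : 0 < A ->
  n%:R^-1 * (\sum_(i < n) y i) @[n --> \oo] --> 0 ->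
  n%:R^-1 * n%:R `^ (- A) * (\sum_(i < n) i.+1%:R `^ A * y i) @[n --> \oo] --> 0.
Proof.
move=> A0 /cvg_mean_affine_bound h; apply/cvgrPdist_le => e e0.
have e4 : 0 < e / 4 by lra.
have [M [M0 hM]] := h _ e4.
near=> n; rewrite sub0r normrN.
have n0 : 0 < n%:R :> R by rewrite ltr0n; near: n; exists 1%N.
have nA : 0 < n%:R `^ A by rewrite powR_gt0.
rewrite sum_by_parts !normrM normfV powRN normfV normr_nat (gtr0_norm nA).
rewrite -invfM mulrC ler_pdivrMr ?mulr_gt0//.
have b1 : `|n%:R `^ A * (\sum_(i < n) y i)| <= n%:R `^ A * (M + e / 4 * n%:R).
  by rewrite normrM (gtr0_norm nA) ler_pM2l.
have b2 : `|\sum_(i < n) (i.+1%:R `^ A - i%:R `^ A) * (\sum_(j < i) y j)| <=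
    n%:R `^ A * (M + e / 4 * n%:R).
  apply: le_trans (ler_norm_sum _ _ _) _.
  apply: (@le_trans _ _ (\sum_(i < n) (i.+1%:R `^ A - i%:R `^ A) *
      (M + e / 4 * n%:R))).
    apply: ler_sum => i _.
    have inc : 0 <= i.+1%:R `^ A - i%:R `^ A.
      by rewrite subr_ge0 ge0_ler_powR ?nnegrE ?ler0n ?ler_nat// ltW.
    rewrite normrM (ger0_norm inc) ler_wpM2l//.
    apply: le_trans (hM i) _; rewrite lerD2l ler_pM2l// ler_nat ltnW//.
  rewrite -mulr_suml -(big_mkord xpredT (fun i => i.+1%:R `^ A - i%:R `^ A)).
  by rewrite telescope_sumr// powR0 ?gt_eqF// subr0.
apply: le_trans (ler_normB _ _) _.
have : M <= e / 4 * n%:R.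
  rewrite mulrC -ler_pdivrMr//; near: n; exact: nbhs_infty_ger.
move: b1 b2; nra.
Unshelve. all: by end_near. Qed.

(** Subtracting L reduces to means tending to 0, and the constant sequence is
    [cvg_sum_powR]. *)
Lemma cvg_weighted_mean A L y : 0 < A ->
  n%:R^-1 * (\sum_(i < n) y i) @[n --> \oo] --> L ->
  n%:R^-1 * n%:R `^ (- A) * (\sum_(i < n) i.+1%:R `^ A * y i) @[n --> \oo] -->
  (A + 1)^-1 * L.
Proof.
move=> A0 yL.
have c0 : n%:R^-1 * (\sum_(i < n) (y i - L)) @[n --> \oo] --> 0.
  rewrite -[X in _ --> X](subrr L).
  apply: cvg_trans (cvgB yL (cvg_cst L)); apply: near_eq_cvg; near=> n => /=.
  rewrite sumrB sumr_const card_ord mulrBr -[L *+ n]mulr_natl mulKf//.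
  by rewrite pnatr_eq0 -lt0n; near: n; exists 1%N.
have E (n : nat) : n%:R^-1 * n%:R `^ (- A) * (\sum_(i < n) i.+1%:R `^ A * y i) =
    n%:R^-1 * n%:R `^ (- A) * (\sum_(i < n) i.+1%:R `^ A * (y i - L)) +
    n%:R^-1 * n%:R `^ (- A) * (\sum_(i < n) i.+1%:R `^ A) * L.
  rewrite -[X in _ + X]mulrA -mulrDr mulr_suml -big_split /=; congr (_ * _).
  by apply: eq_bigr => i _; ring.
under eq_fun do rewrite E.
rewrite -[(A + 1)^-1 * L]add0r; apply: cvgD; last first.
  by apply: cvgM; [exact: cvg_sum_powR|exact: cvg_cst].
exact: (cvg_weighted_mean0 (y := fun i => y i - L)).
Unshelve. all: by end_near. Qed.

Lemma cvg_mean y L : y n @[n --> \oo] --> L ->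
  n%:R^-1 * (\sum_(i < n) y i) @[n --> \oo] --> L.
Proof.
move=> /cesaro; rewrite /arithmetic_mean seriesEord => h.
by rewrite -(cvg_shiftS (fun n => n%:R^-1 * (\sum_(i < n) y i))).
Qed.

End WeightedMean.

(** * A strong law of large numbers for eventually uncorrelated variables *)

Lemma sqr_sum_le (R : realFieldType) (n : nat) (a : nat -> R) :
  (\sum_(i < n) a i) ^+ 2 <= n%:R * \sum_(i < n) a i ^+ 2.
Proof.
elim: n => [|n IH]; first by rewrite !big_ord0 expr0n mulr0.
rewrite !big_ord_recr /=.
set S := \sum_(i < n) a i in IH *; set Q := \sum_(i < n) a i ^+ 2 in IH *.
have cross : a n *+ 2 * S <= Q + n%:R * a n ^+ 2.
  have -> : n%:R * a n ^+ 2 = \sum_(i < n) a n ^+ 2.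
    by rewrite sumr_const card_ord mulr_natl.
  rewrite mulr_sumr -big_split; apply: ler_sum => i _ /=.
  by have := sqr_ge0 (a i - a n); rewrite mulr2n; lra.
rewrite -natr1; nra.
Qed.

(** Locates n in the blocks between consecutive squares, on which the strong law
    below is proved. *)
Lemma nat_between_squares (n : nat) :
  exists q : nat, (q ^ 2 <= n < q.+1 ^ 2)%N.
Proof.
elim: n => [|n [q /andP[q1 q2]]]; first by exists 0%N.
have [h|h] := ltnP n.+1 (q.+1 ^ 2).
  by exists q; rewrite h (leq_trans q1).
exists q.+1; rewrite h /=.
by apply: leq_ltn_trans q2 _; rewrite ltn_exp2r.
Qed.

Lemma sum_inv_sqr_le2 (R : realFieldType) (n : nat) :
  \sum_(i < n) (i.+1%:R ^+ 2)^-1 <= 2 :> R.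
Proof.
have H m : \sum_(i < m.+1) (i.+1%:R ^+ 2)^-1 <= 2 - m.+1%:R^-1 :> R.
  elim: m => [|m IH]; first by rewrite big_ord1 expr1n invr1; lra.
  rewrite big_ord_recr /=; apply: le_trans (lerD IH (lexx _)) _.
  have x0 : 0 < m.+1%:R :> R by [].
  have -> : m.+2%:R = m.+1%:R + 1 :> R by rewrite -natr1.
  move: (m.+1%:R) x0 => x x0.
  rewrite -subr_ge0 (_ : _ - _ = (x * (x + 1) ^+ 2)^-1); last by field; lra.
  by rewrite invr_ge0 mulr_ge0 ?sqr_ge0// ltW.
case: n => [|n]; first by rewrite big_ord0.
by apply: le_trans (H n) _; rewrite lerBlDr lerDl invr_ge0.
Qed.

(** Among the indices before n, at most K are within distance K of n: these are
    the only ones that can be correlated with n. *)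
Lemma count_last_le (R : realFieldType) (n K : nat) :
  \sum_(j < n) ((n <= j + K)%N)%:R <= K%:R :> R.
Proof.
rewrite -natr_sum ler_nat (reindex_inj rev_ord_inj) /=.
rewrite (eq_bigr (fun j : 'I_n => (j < K)%N : nat)); last first.
  by move=> j _; congr (nat_of_bool _); have := ltn_ord j; lia.
apply: (@leq_trans (minn n K)); last exact: geq_minr.
elim: n => [|n IH]; first by rewrite big_ord0.
by rewrite big_ord_recr /=; lia.
Qed.

Section StrongLaw.
Context (disp : measure_display) (T : measurableType disp) (R : realType)
  (P : probability T R).
Implicit Types f g : T -> R.

Local Notation intg f := (P.-integrable setT (EFin \o f)).

Definition square_integrable f :=
  measurable_fun setT f /\ intg (fun w => f w ^+ 2).

Lemma integrable_realD f g : intg f -> intg g -> intg (fun w => f w + g w).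
Proof. by move=> fi gi; exact: (integrableD measurableT fi gi). Qed.

Lemma integrable_realZ c f : intg f -> intg (fun w => c * f w).
Proof. by move=> fi; exact: (integrableZl measurableT c fi). Qed.

Lemma integrable_real_cst c : intg (fun=> c).
Proof. exact: (finite_measure_integrable_cst P c). Qed.

Lemma Rintegral_sum (J : Type) (s : seq J) (F : J -> T -> R) :
  (forall i, intg (F i)) ->
  intg (fun w => \sum_(i <- s) F i w) /\
  \int[P]_w (\sum_(i <- s) F i w) = \sum_(i <- s) \int[P]_w F i w.
Proof.
move=> Fi; elim: s => [|i s [IH1 IH2]].
  split; first by under eq_fun do rewrite big_nil; exact: integrable_real_cst.
  under eq_Rintegral do rewrite big_nil.
  by rewrite big_nil Rintegral_cst_probability.
have E w : \sum_(j <- i :: s) F j w = F i w + \sum_(j <- s) F j w.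
  by rewrite big_cons.
split.
  by under eq_fun do rewrite E; exact: integrable_realD.
by under eq_Rintegral do rewrite E; rewrite RintegralD// IH2 big_cons.
Qed.

Lemma square_integrableM f g : square_integrable f -> square_integrable g ->
  intg (fun w => f w * g w) /\
  \int[P]_w (f w * g w) <= (\int[P]_w (f w ^+ 2) + \int[P]_w (g w ^+ 2)) / 2.
Proof.
move=> [mf f2] [mg g2].
have i2 : intg (fun w => 2^-1 * (f w ^+ 2 + g w ^+ 2)).
  by apply: integrable_realZ; exact: integrable_realD.
have le w : `|f w * g w| <= 2^-1 * (f w ^+ 2 + g w ^+ 2).
  rewrite normrM -(real_normK (num_real (f w))) -(real_normK (num_real (g w))).
  have := sqr_ge0 (`|f w| - `|g w|); lra.
have ifg : intg (fun w => f w * g w).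
  apply: le_integrable i2 => //; first exact/measurable_EFinP/measurable_funM.
  move=> w _ /=; rewrite lee_fin (le_trans (le w))// ler_norm.
  by [].
split => //; rewrite mulrC -RintegralD//.
rewrite -RintegralZl//; last exact: integrable_realD.
apply: le_Rintegral => // w _; exact: (le_trans (ler_norm _) (le w)).
Qed.

Lemma square_integrableD f g : square_integrable f -> square_integrable g ->
  square_integrable (fun w => f w + g w).
Proof.
move=> sf sg; have [mf f2] := sf; have [mg g2] := sg.
split; first exact: measurable_funD.
have [fg _] := square_integrableM sf sg.
have -> : (fun w => (f w + g w) ^+ 2) = (fun w => f w ^+ 2 + 
    (f w * g w + (f w * g w + g w ^+ 2))).
  by apply/funext => w; ring.
by do 3 (apply: integrable_realD => //).
Qed.

Lemma square_integrable_cst c : square_integrable (fun=> c).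
Proof.
by split => //; exact: integrable_real_cst.
Qed.

Lemma square_integrable_sum (J : Type) (s : seq J) (F : J -> T -> R) :
  (forall i, square_integrable (F i)) ->
  square_integrable (fun w => \sum_(i <- s) F i w).
Proof.
move=> Fi; elim: s => [|i s IH].
  by under eq_fun do rewrite big_nil; exact: square_integrable_cst.
by under eq_fun do rewrite big_cons; exact: square_integrableD.
Qed.

Lemma square_integrable_norm f : square_integrable f ->
  square_integrable (fun w => `|f w|).
Proof.
move=> [mf f2]; split; first exact: measurableT_comp.
by under eq_fun do rewrite real_normK ?num_real//.
Qed.

Lemma square_integrable_integrable f : square_integrable f -> intg f.
Proof.
move=> sf; have [+ _] := square_integrableM sf (square_integrable_cst 1).
by under eq_fun do rewrite mulr1.
Qed.

(** The sum of all the f n has a finite integral, so it is finite almost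
    everywhere, and there its terms tend to 0. *)
Lemma ae_cvg0_of_summable (f : nat -> T -> R) (M : R) :
  (forall n, intg (f n)) -> (forall n w, 0 <= f n w) ->
  (forall n, \sum_(i < n) \int[P]_w f i w <= M) ->
  {ae P, forall w, f n w @[n --> \oo] --> 0}.
Proof.
move=> fi f0 fM.
have mf n : measurable_fun setT (fun w => (f n w)%:E).
  exact: (measurable_int _ (fi n)).
have f0e n w : (0 <= (f n w)%:E)%E by rewrite lee_fin.
pose g w := (\sum_(n <oo) (f n w)%:E)%E.
have mg : measurable_fun setT g.
  by apply: ge0_emeasurable_sum => // n w _ _; exact: f0e.
have gi : P.-integrable setT g.
  apply/integrableP; split=> //.
  under eq_integral do rewrite gee0_abs ?nneseries_ge0//.
  rewrite integral_nneseries//; apply: le_lt_trans (ltry M).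
  apply: lime_le.
    by apply: is_cvg_nneseries => n _ _; apply: integral_ge0 => w _.
  apply: nearW => n; rewrite big_mkord.
  apply: le_trans (_ : (\sum_(i < n) \int[P]_w f i w)%:E <= _)%E; last first.
    by rewrite lee_fin.
  by rewrite -sumEFin; apply: lee_sum => i _; rewrite EFin_Rintegral.
apply: filterS (integrable_ae measurableT gi) => w /(_ Logic.I) gfin.
apply: (@cvg_series_cvg_0 R R^o).
apply: nondecreasing_is_cvgn.
  by apply/nondecreasing_seqP => n; rewrite !seriesEord /= big_ord_recr lerDl.
exists (fine (g w)) => _ [n _ <-]; rewrite -lee_fin fineK// seriesEord.
rewrite -sumEFin -(big_mkord xpredT (fun i => (f i w)%:E)).
exact: nneseries_lim_ge.
Qed.

Section Centered.
Variables (Z : nat -> T -> R) (C : R) (K : nat).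
Hypothesis Z2 : forall i, square_integrable (Z i).
Hypothesis ZC : forall i, \int[P]_w (Z i w ^+ 2) <= C.
Hypothesis Zcov : forall i j, (i + K < j)%N -> \int[P]_w (Z i w * Z j w) = 0.

Let ZiZj i j : intg (fun w => Z i w * Z j w).
Proof. by have [] := square_integrableM (Z2 i) (Z2 j). Qed.

Let ZijC i j : \int[P]_w (Z i w * Z j w) <= C.
Proof.
have [_ /le_trans] := square_integrableM (Z2 i) (Z2 j); apply.
by have := ZC i; have := ZC j; lra.
Qed.

Let C0 : 0 <= C.
Proof. by apply: le_trans (ZC 0); apply: Rintegral_ge0 => w _; exact: sqr_ge0. Qed.

(** Adding the n-th term creates at most K nonzero covariances, each at most
    C. *)
Lemma variance_sum_le n :
  \int[P]_w ((\sum_(i < n) Z i w) ^+ 2) <= n%:R * (K.*2.+1%:R * C).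
Proof.
elim: n => [|n IH].
  under eq_Rintegral do rewrite big_ord0 expr0n.
  by rewrite Rintegral_cst_probability mul0r.
have sS := square_integrable_sum (index_enum 'I_n) (fun i : 'I_n => Z2 i).
have [iSZ _] := square_integrableM sS (Z2 n).
have E w : (\sum_(i < n.+1) Z i w) ^+ 2 = (\sum_(i < n) Z i w) ^+ 2 +
    (2 * (\sum_(i < n) Z i w * Z n w) + Z n w ^+ 2).
  by rewrite big_ord_recr /= -mulr_suml; ring.
under eq_Rintegral do rewrite E.
have [iS2 [iZ2 [iSS ES]]] : intg (fun w => (\sum_(i < n) Z i w) ^+ 2) /\
    intg (fun w => Z n w ^+ 2) /\
    (intg (fun w => \sum_(i < n) Z i w * Z n w) /\
    \int[P]_w (\sum_(i < n) Z i w * Z n w) =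
      \sum_(i < n) \int[P]_w (Z i w * Z n w)).
  by split; [exact: sS.2|split; [exact: (Z2 n).2|exact: Rintegral_sum]].
rewrite RintegralD//; last by apply: integrable_realD => //; exact: integrable_realZ.
rewrite RintegralD//; last exact: integrable_realZ.
rewrite RintegralZl// ES.
have : \sum_(i < n) \int[P]_w (Z i w * Z n w) <= K%:R * C.
  apply: le_trans (ler_wpM2r C0 (count_last_le R n K)).
  rewrite mulr_suml; apply: ler_sum => i _.
  case: leqP => [_|/Zcov ->]; first by rewrite mul1r.
  by rewrite mul0r.
have := ZC n; move: IH; rewrite -[n.+1%:R]natr1 -[K.*2.+1%:R]natr1 -mul2n natrM.
nra.
Qed.

(* Bounds every partial sum of the terms of index q ^ 2 up to (q + 1) ^ 2. *)
Let block (q : nat) (w : T) := \sum_(i < q.*2.+1) `|Z (q ^ 2 + i)%N w|.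

Let block2 q : square_integrable (block q).
Proof. by apply: square_integrable_sum => i; exact: square_integrable_norm. Qed.

Let block_le q : \int[P]_w (block q w ^+ 2) <= q.*2.+1%:R ^+ 2 * C.
Proof.
pose G w := \sum_(i < q.*2.+1) Z (q ^ 2 + i)%N w ^+ 2.
have [iG EG] : intg G /\ \int[P]_w G w =
    \sum_(i < q.*2.+1) \int[P]_w (Z (q ^ 2 + i)%N w ^+ 2).
  by apply: Rintegral_sum => i; exact: (Z2 _).2.
apply: (@le_trans _ _ (\int[P]_w (q.*2.+1%:R * G w))).
  apply: le_Rintegral => //; first exact: (block2 q).2.
    exact: integrable_realZ.
  move=> w _; have := sqr_sum_le q.*2.+1 (fun i => `|Z (q ^ 2 + i)%N w|).
  rewrite /block /G; under [X in _ <= _ * X -> _]eq_bigr do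
    rewrite real_normK ?num_real//.
  by [].
rewrite RintegralZl// EG expr2 -mulrA ler_wpM2l//.
apply: le_trans (ler_sum _ (fun i _ => ZC _)) _.
by rewrite sumr_const card_ord mulr_natl.
Qed.

(** The variance of the mean at q ^ 2 and that of block q over q ^ 2 are both
    O(1 / q ^ 2), hence summable.  So the means converge along the squares, and
    the block controls the oscillation between two squares. *)
Lemma strong_law_centered :
  {ae P, forall w, n%:R^-1 * (\sum_(i < n) Z i w) @[n --> \oo] --> 0}.
Proof.
pose S n w := \sum_(i < n) Z i w.
pose f j w := ((j.+1%:R ^+ 2)^-1) ^+ 2 *
  (S (j.+1 ^ 2)%N w ^+ 2 + block j.+1 w ^+ 2).
have S2 n : square_integrable (S n) by exact: square_integrable_sum.
have f_int j : intg (f j).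
  apply: integrable_realZ; apply: integrable_realD; first exact: (S2 _).2.
  exact: (block2 _).2.
have f_le j : \int[P]_w f j w <= (j.+1%:R ^+ 2)^-1 * ((K.*2.+1%:R + 9) * C).
  rewrite RintegralZl//; last first.
    by apply: integrable_realD; [exact: (S2 _).2|exact: (block2 _).2].
  rewrite RintegralD//; [|exact: (S2 _).2|exact: (block2 _).2].
  have j0 : 0 < j.+1%:R ^+ 2 :> R by rewrite exprn_gt0.
  rewrite expr2 -mulrA ler_pM2l ?invr_gt0// ler_pdivrMl//.
  have := variance_sum_le (j.+1 ^ 2); have := block_le j.+1; rewrite natrX.
  have : (j.+1.*2.+1)%:R ^+ 2 <= 9 * j.+1%:R ^+ 2 :> R.
    by rewrite -!natrX -natrM ler_nat; nia.
  have := C0; rewrite -/(S _ _); nra.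
have f_cvg : {ae P, forall w, f j w @[j --> \oo] --> 0}.
  apply: (@ae_cvg0_of_summable f (2 * ((K.*2.+1%:R + 9) * C))) => //.
    by move=> j w; rewrite mulr_ge0 ?sqr_ge0// addr_ge0 ?sqr_ge0.
  move=> n; apply: (@le_trans _ _
      (\sum_(i < n) (i.+1%:R ^+ 2)^-1 * ((K.*2.+1%:R + 9) * C))).
    by apply: ler_sum => i _.
  by rewrite -mulr_suml ler_wpM2r ?sum_inv_sqr_le2// mulr_ge0 ?C0.
apply: filterS f_cvg => w fw; apply/cvgrPdist_le => e e0.
have e2 : 0 < (e / 2) ^+ 2 by rewrite exprn_gt0// divr_gt0.
move/cvgrPdist_le : fw => /(_ _ e2) [J _ HJ].
exists (J.+1 ^ 2)%N => // n /= Jn; rewrite sub0r normrN.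
have [q /andP[q1 q2]] := nat_between_squares n.
have Jq : (J < q)%N.
  by rewrite -ltnS -(@ltn_exp2r _ _ 2)// (leq_ltn_trans Jn).
case: q q1 q2 Jq => // q q1 q2 Jq.
have Q0 : 0 < q.+1%:R ^+ 2 :> R by rewrite exprn_gt0.
have e20 : 0 <= e / 2 * q.+1%:R ^+ 2.
  by rewrite mulr_ge0// ltW// divr_gt0.
have S_split : `|\sum_(i < n) Z i w| <= `|S (q.+1 ^ 2)%N w| + block q.+1 w.
  rewrite -(subnKC q1) big_split_ord /= (le_trans (ler_normD _ _))// lerD2l.
  apply: le_trans (ler_norm_sum _ _ _) _.
  have m_le : (n - q.+1 ^ 2 <= q.+1.*2.+1)%N by lia.
  rewrite /block (big_ord_widen _ (fun i => `|Z (q.+1 ^ 2 + i)%N w|) m_le).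
  rewrite [leRHS](bigID (fun i : 'I_ _ => (i < n - q.+1 ^ 2)%N)) /= lerDl.
  exact: sumr_ge0.
have := HJ q Jq; rewrite sub0r normrN ger0_norm; last first.
  by rewrite mulr_ge0 ?sqr_ge0// addr_ge0 ?sqr_ge0.
rewrite /f exprVn mulrC ler_pdivrMr ?exprn_gt0// -exprMn => SB.
have sqr_le x : x ^+ 2 <= (e / 2 * q.+1%:R ^+ 2) ^+ 2 ->
    `|x| <= e / 2 * q.+1%:R ^+ 2.
  by rewrite -[x ^+ 2]real_normK ?num_real// ler_pXn2r ?nnegrE.
have S_le : `|S (q.+1 ^ 2)%N w| <= e / 2 * q.+1%:R ^+ 2.
  by apply: sqr_le; apply: le_trans SB; rewrite lerDl sqr_ge0.
have B_le : block q.+1 w <= e / 2 * q.+1%:R ^+ 2.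
  apply: le_trans (ler_norm _) (sqr_le _ _).
  by apply: le_trans SB; rewrite lerDr sqr_ge0.
have n0 : 0 < n%:R :> R by rewrite ltr0n (leq_trans _ q1)// expn_gt0.
rewrite normrM normfV normr_nat ler_pdivrMl//.
apply: le_trans S_split _.
have : e * q.+1%:R ^+ 2 <= n%:R * e.
  by rewrite mulrC ler_pM2r// -natrX ler_nat.
by move: S_le B_le; lra.
Qed.
End Centered.

Lemma Rintegral_centeredM (f g : T -> R) (a b : R) :
  square_integrable f -> square_integrable g ->
  \int[P]_w ((f w - a) * (g w - b)) =
  \int[P]_w (f w * g w) - b * \int[P]_w f w - a * \int[P]_w g w + a * b.
Proof.
move=> sf sg; have [fg _] := square_integrableM sf sg.
have fi := square_integrable_integrable sf.
have gi := square_integrable_integrable sg.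
have E w : (f w - a) * (g w - b) =
  f w * g w + ((- b) * f w + ((- a) * g w + a * b)) by ring.
under eq_Rintegral do rewrite E.
have i1 : intg (fun w => (- b) * f w) by exact: integrable_realZ.
have i2 : intg (fun w => (- a) * g w) by exact: integrable_realZ.
have i3 : intg (fun w => (- a) * g w + a * b).
  by apply: integrable_realD => //; exact: integrable_real_cst.
have i4 : intg (fun w => (- b) * f w + ((- a) * g w + a * b)).
  exact: integrable_realD.
rewrite RintegralD// RintegralD// RintegralD//; last exact: integrable_real_cst.
by rewrite Rintegral_cst_probability !RintegralZl//; ring.
Qed.

(** The covariances at distance at most K are arbitrary, so that each Z i may
    depend on K + 1 consecutive groups of independent variables. *)
Lemma strong_law (Z : nat -> T -> R) (C L : R) (K : nat) :
  (forall i, square_integrable (Z i)) ->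
  (forall i, \int[P]_w (Z i w ^+ 2) <= C) ->
  (forall i j, (i + K < j)%N ->
    \int[P]_w (Z i w * Z j w) = \int[P]_w Z i w * \int[P]_w Z j w) ->
  \int[P]_w Z i w @[i --> \oo] --> L ->
  {ae P, forall w, n%:R^-1 * (\sum_(i < n) Z i w) @[n --> \oo] --> L}.
Proof.
move=> Z2 ZC Zcov ZL; pose e i := \int[P]_w Z i w.
have := @strong_law_centered (fun i w => Z i w - e i) C K.
have h1 i : square_integrable (fun w => Z i w - e i).
  by apply: square_integrableD => //; exact: square_integrable_cst.
have h2 i : \int[P]_w ((Z i w - e i) ^+ 2) <= C.
  under eq_Rintegral do rewrite expr2.
  rewrite Rintegral_centeredM// -/(e i).
  have := ZC i; under eq_Rintegral do rewrite expr2.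
  have := sqr_ge0 (e i); lra.
have h3 i j : (i + K < j)%N -> \int[P]_w ((Z i w - e i) * (Z j w - e j)) = 0.
  move=> /Zcov; rewrite Rintegral_centeredM// => ->.
  by rewrite -/(e i) -/(e j); ring.
move=> /(_ h1 h2 h3); apply: filterS => w /= Zw.
have E n : n%:R^-1 * (\sum_(i < n) Z i w) =
    n%:R^-1 * (\sum_(i < n) (Z i w - e i)) + n%:R^-1 * (\sum_(i < n) e i).
  rewrite -mulrDr -big_split; congr (_ * _).
  by apply: eq_bigr => i _ /=; rewrite subrK.
under eq_fun do rewrite E.
by rewrite -[L]add0r; apply: cvgD => //; exact: cvg_mean.
Qed.

End StrongLaw.

(** * Closed walks and the trace of a product of matrices *)

Lemma big_tuple_cons (R : Type) (idx : R) (op : Monoid.com_law idx)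
    (X : finType) (k : nat) (F : k.+1.-tuple X -> R) :
  \big[op/idx]_(f : k.+1.-tuple X) F f =
  \big[op/idx]_(x : X) \big[op/idx]_(f : k.-tuple X) F [tuple of x :: f].
Proof.
rewrite pair_big /= (reindex (fun p : X * k.-tuple X => [tuple of p.1 :: p.2])) //.
exists (fun f : k.+1.-tuple X => (thead f, [tuple of behead f])) => [[x f] _|f _] /=.
  by rewrite theadE; congr pair; apply: val_inj.
by rewrite -tuple_eta.
Qed.

Section TracePaths.
Context (R : comNzRingType) (n : nat) (i0 : 'I_n).

(** Walks are tuples of k + 1 indices, read with [nth] so that positions t and
    t.+1 need no casts. *)
Lemma prodmx_entry (k : nat) (M : 'I_k -> 'M[R]_n) (i j : 'I_n) :
  (\prod_(t < k) M t) i j =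
  \sum_(f : k.+1.-tuple 'I_n | (nth i0 f 0 == i) && (nth i0 f k == j))
    \prod_(t < k) M t (nth i0 f t) (nth i0 f t.+1).
Proof.
elim: k M i => [|k IH] M i.
  rewrite big_ord0 mxE big_mkcond big_tuple_cons (bigD1 i)//=
    [X in _ + X]big1 ?addr0.
    rewrite (eq_bigl (pred1 [tuple])) ?big_pred1_eq/=; last first.
      by move=> f; apply/esym/eqP; rewrite [f]tuple0; apply: val_inj.
    by rewrite eqxx big_ord0; case: eqP.
  move=> x /negbTE xi; rewrite big1// => f _ /=; rewrite xi//.
rewrite big_ord_recl mxE [RHS]big_mkcond big_tuple_cons [RHS](bigD1 i)//=
  [X in _ = _ + X]big1.
  rewrite addr0; under eq_bigr do rewrite IH mulr_sumr.
  rewrite -big_mkcond/=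
    (eq_bigl (fun f : k.+1.-tuple 'I_n => nth i0 f k == j)); last first.
    by move=> f; rewrite eqxx.
  rewrite [RHS](partition_big (fun f : k.+1.-tuple 'I_n => nth i0 f 0) xpredT)//=.
  apply: eq_bigr => l _; apply: eq_big => [f|f /andP[/eqP <- _]].
    by rewrite andbC.
  by rewrite big_ord_recl.
by move=> x /negbTE xi; rewrite big1// => f _ /=; rewrite xi.
Qed.

(** The diagonal entry at i collects the walks closed at i. *)
Lemma trace_prodmx (k : nat) (M : 'I_k -> 'M[R]_n) :
  \tr (\prod_(t < k) M t) =
  \sum_(f : k.+1.-tuple 'I_n | nth i0 f 0 == nth i0 f k)
    \prod_(t < k) M t (nth i0 f t) (nth i0 f t.+1).
Proof.
rewrite /mxtrace (partition_big (fun f : k.+1.-tuple 'I_n => nth i0 f 0) xpredT)//=.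
apply: eq_bigr => i _; rewrite prodmx_entry; apply: eq_bigl => f.
by rewrite [in RHS]andbC; case: eqP => //= ->; rewrite eq_sym.
Qed.

End TracePaths.

Lemma unit_steps_close (k : nat) (a : nat -> nat) :
  (forall t, t < k -> a t <= a t.+1 + 1 /\ a t.+1 <= a t + 1)%N ->
  forall s t, (s <= k -> t <= k -> a t <= a s + k)%N.
Proof.
move=> ha s t sk tk.
have up j : (s + j <= k -> a (s + j) <= a s + j)%N.
  elim: j => [|j IH] jk; first by rewrite !addn0.
  have [_ h1] := ha (s + j)%N (ltac:(lia)).
  have h2 := IH (ltac:(lia)); rewrite !addnS; lia.
have down j : (j <= s -> a (s - j) <= a s + j)%N.
  elim: j => [|j IH] js; first by rewrite subn0 addn0.
  have [+ _] := ha (s - j.+1)%N (ltac:(lia)).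
  by have := IH (ltac:(lia)); rewrite subnSK//; lia.
have [st|ts] := leqP s t.
  by have := up (t - s)%N (ltac:(lia)); rewrite subnKC//; lia.
by have := down (s - t)%N (ltac:(lia)); rewrite subKn ?(ltnW ts)//; lia.
Qed.

Section Shapes.
Context (k : nat).
Implicit Types h : k.+1.-tuple 'I_k.+1.

(** A nat-valued and total reading of h, so that positions t and t.+1 can be
    compared without casts. *)
Definition depth h (t : nat) : nat := nth ord0 h t.

Definition unit_step (a b : nat) := (a <= b.+1)%N && (b <= a.+1)%N.

Definition is_shape h :=
  [&& depth h 0 == depth h k,
      [forall t : 'I_k, unit_step (depth h t) (depth h t.+1)] &
      [exists t : 'I_k.+1, depth h t == 0%N]].

(** A closed walk with steps -1, 0 or 1 is the translate by its minimum p of a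
    unique shape; the shape has values at most k because k such steps cannot go
    further. *)
Lemma sum_closed_walks (R : comNzRingType) (n : nat)
    (E : 'I_k -> nat -> nat -> R) :
  (forall t a b, ~~ unit_step a b -> E t a b = 0) ->
  \sum_(f : k.+1.-tuple 'I_n.+1 | nth ord0 f 0 == nth ord0 f k)
    \prod_(t < k) E t (nth ord0 f t) (nth ord0 f t.+1) =
  \sum_(h | is_shape h)
    \sum_(p < n.+1 | [forall t : 'I_k.+1, (p + depth h t < n.+1)%N])
      \prod_(t < k) E t (p + depth h t)%N (p + depth h t.+1)%N.
Proof.
move=> E0.
pose good (f : k.+1.-tuple 'I_n.+1) := (nth ord0 f 0 == nth ord0 f k) &&
  [forall t : 'I_k, unit_step (nth ord0 f t) (nth ord0 f t.+1)].
rewrite (bigID [pred f : k.+1.-tuple 'I_n.+1 |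
  [forall t : 'I_k, unit_step (nth ord0 f t) (nth ord0 f t.+1)]])/=.
(* Walks with a longer jump have weight 0. *)
rewrite [X in _ + X]big1 ?addr0; last first.
  move=> f /andP[_]; rewrite negb_forall => /existsP[t /E0 Et].
  by rewrite (bigD1 t)//= Et mul0r.
rewrite pair_big_dep /=.
have tle (t : 'I_k.+1) : (t <= k)%N by rewrite -ltnS.
(* Translation of the shape q.1 to the minimum q.2. *)
pose phi (q : k.+1.-tuple 'I_k.+1 * 'I_n.+1) : k.+1.-tuple 'I_n.+1 :=
  [tuple of [seq inord (q.2 + x) | x : 'I_k.+1 <- q.1]].
pose A := [set q : k.+1.-tuple 'I_k.+1 * 'I_n.+1 | is_shape q.1 &&
  [forall t : 'I_k.+1, (q.2 + depth q.1 t < n.+1)%N]]%SET.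
have phiE q t : q \in A -> (t <= k)%N ->
    nth ord0 (phi q) t = (q.2 + depth q.1 t)%N :> nat.
  rewrite inE => /andP[_ /forallP qn] tk.
  rewrite (nth_map ord0) ?size_tuple// inordK//.
  exact: (qn (Ordinal (tk : t < k.+1)%N)).
have phi_inj : {in A &, injective phi}.
  move=> [h p] [h' p'] qA qA' E12.
  have e t : (t <= k)%N -> (p + depth h t = p' + depth h' t)%N.
    by move=> tk; rewrite -(phiE (h, p))// E12 phiE.
  have pp : p = p'.
    move: qA qA'; rewrite !inE /= => /andP[/and3P[_ _ /existsP[s /eqP hs]] _].
    move=> /andP[/and3P[_ _ /existsP[s' /eqP hs']] _].
    apply: val_inj => /=; have sk := ltn_ord s; have sk' := ltn_ord s'.
    have e1 := e s (ltac:(lia)); have e2 := e s' (ltac:(lia)).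
    by move: e1 e2; rewrite hs hs'; lia.
  congr pair => //; apply: eq_from_tnth => t; apply: val_inj => /=.
  by have := e t; rewrite -pp /depth !(tnth_nth ord0) => /(_ (tle _))/addnI ->.
have phi_im f : (f \in phi @: A) = good f.
  apply/imsetP/idP => [[q qA ->]|].
    move: (qA); rewrite inE => /andP[/and3P[/eqP h0k /forallP hst _] _].
    apply/andP; split; first by apply/eqP/val_inj => /=; rewrite !phiE// h0k.
    apply/forallP => t; rewrite !phiE//; last exact: ltnW.
    by case/andP: (hst t) => s1 s2; rewrite /unit_step -!addnS !leq_add2l s1.
  move=> /andP[/eqP f0k /forallP fst].
  pose a t := nat_of_ord (nth ord0 f t).
  have close s t : (s <= k)%N -> (t <= k)%N -> (a t <= a s + k)%N.
    apply: unit_steps_close => {}t tk; have := fst (Ordinal tk).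
    by rewrite /unit_step /= !addn1 => /andP.
  have [s _ smin] := arg_minnP (fun t : 'I_k.+1 => a t) (isT : xpredT ord0).
  have hk t : (t <= k)%N -> (a t - a s < k.+1)%N.
    by move=> tk; have sk := ltn_ord s; have := close s t (ltac:(lia)) tk; lia.
  pose h : k.+1.-tuple 'I_k.+1 := [tuple inord (a t - a s) | t < k.+1].
  have hE t : (t <= k)%N -> depth h t = (a t - a s)%N.
    move=> tk; have tk' : (t < k.+1)%N by [].
    rewrite /depth -(tnth_nth ord0 h (Ordinal tk')) tnth_mktuple inordK//.
    exact: hk.
  have amin t : (t <= k)%N -> (a s <= a t)%N.
    by move=> tk; have := smin (Ordinal (tk : t < k.+1)%N) isT.
  have hA : (h, nth ord0 f s) \in A.
    rewrite inE /=; apply/andP; split.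
      apply/and3P; split.
      - by rewrite !hE// /a f0k.
      - apply/forallP => t; rewrite !hE//; last exact: ltnW.
        have tk := ltn_ord t; have a1 := amin t (ltac:(lia)).
        have a2 := amin t.+1 tk; have b : unit_step (a t) (a t.+1) := fst t.
        by case/andP: b => b1 b2; apply/andP; split; lia.
      - by apply/existsP; exists s; rewrite hE ?subnn.
    apply/forallP => t; rewrite hE// subnKC; last exact: amin.
    exact: ltn_ord.
  exists (h, nth ord0 f s) => //.
  apply: eq_from_tnth => t; apply: val_inj => /=.
  rewrite !(tnth_nth ord0) phiE//=.
  by rewrite hE// subnKC; last exact: amin.
rewrite (eq_bigl (fun f => f \in phi @: A)); last by move=> f; rewrite phi_im.
rewrite big_imset//; apply: eq_big => [q|q qA]; first by rewrite inE.
by apply: eq_bigr => t _; rewrite !phiE// ltnW.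
Qed.

End Shapes.

(** * Walks with nonzero steps and the paths of Gamma *)

(** As the starting value x0 belongs to s, the fold is a genuine maximum over
    s. *)
Lemma bigmax_int_eq0 (s : seq int) (x0 : int) : x0 \in s ->
  \big[Order.max/x0]_(j <- s) j = 0 <-> (0 \in s /\ {in s, forall j, j <= 0}).
Proof.
move=> x0s; have max_in (s' : seq int) :
    {subset s' <= s} -> \big[Order.max/x0]_(j <- s') j \in s.
  elim: s' => [|j s' IH] ss; first by rewrite big_nil.
  rewrite big_cons; case: leP => _; last by apply: ss; rewrite inE eqxx.
  by apply: IH => i is'; apply: ss; rewrite inE is' orbT.
split=> [E|[s0 sle]].
  split; first by rewrite -E max_in.
  by move=> j js; rewrite -E; exact: (@bigmax_sup_seq _ _ _ _ _ j).
apply: le_anti; apply/andP; split.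
  by rewrite big_seq; apply: bigmax_le => [|j]; exact: sle.
exact: (@bigmax_sup_seq _ _ _ _ _ 0).
Qed.

Section GammaShapes.
Context (k : nat).
Implicit Types h : k.+1.-tuple 'I_k.+1.

Definition is_strict h := [forall t : 'I_k, depth h t != depth h t.+1].

(** Depths grow downwards from the first row, heights upwards: the height is the
    opposite of the depth. *)
Definition path_of_depths h : k.+1.-tuple int :=
  [tuple of [seq - (x : nat)%:Z | x : 'I_k.+1 <- h]].

Lemma path_of_depthsE h t : (path_of_depths h)`_t = - (depth h t)%:Z.
Proof.
have [tk|kt] := ltnP t k.+1.
  by rewrite (nth_map ord0) ?size_tuple.
by rewrite /depth !nth_default ?size_tuple// oppr0.
Qed.

(** Conversely, a path of Gamma k reaches height 0 and makes k unit steps, so its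
    heights lie between -k and 0 and their opposites form a shape. *)
Lemma Gamma_path_of_depths :
  set_bij [set h | is_shape h && is_strict h] (Gamma k) path_of_depths.
Proof.
have memP (g : k.+1.-tuple int) j :
    reflect (exists2 t, (t <= k)%N & g`_t = j) (j \in (g : seq int)).
  apply: (iffP (nthP 0)) => [[t + <-]|[t tk <-]]; last first.
    by exists t; rewrite ?size_tuple.
  by rewrite size_tuple => tk; exists t.
have tle (t : 'I_k.+1) : (t <= k)%N by rewrite -ltnS.
have mem0 (g : k.+1.-tuple int) : g`_0 \in (g : seq int).
  by apply/memP; exists 0%N.
split.
- move=> h /= /andP[/and3P[/eqP h0k /forallP hst /existsP[s /eqP hs]] /forallP hne].
  split.
  + by rewrite !path_of_depthsE h0k.
  + move=> t tk; rewrite !path_of_depthsE.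
    have := hst (Ordinal tk); have := hne (Ordinal tk).
    move: (depth h t) (depth h t.+1) => a b.
    rewrite /unit_step /= => /eqP ab /andP[ab1 ab2].
    have [e|e] : a = b.+1 \/ b = a.+1 by lia.
      by rewrite e -addn1 PoszD opprD addrAC opprK addNr add0r normrN1.
    by rewrite e -addn1 PoszD opprK addrA addNr add0r normr1.
  + apply/bigmax_int_eq0; first exact: mem0.
    split; first by apply/memP; exists s; rewrite ?path_of_depthsE ?hs ?tle.
    by move=> j /memP[t _ <-]; rewrite path_of_depthsE oppr_le0.
- move=> h h' _ _ /= E; apply: eq_from_tnth => t; apply: val_inj => /=.
  have := path_of_depthsE h t; rewrite E path_of_depthsE /depth => /eqP.
  by rewrite eqr_opp eqz_nat !(tnth_nth ord0) => /eqP.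
move=> g [g0k gst /(bigmax_int_eq0 (mem0 g))[/memP[s sk gs] gle]].
pose a t := absz g`_t.
have gE t : (t <= k)%N -> g`_t = - (a t)%:Z.
  move=> tk; have : g`_t <= 0 by apply: gle; apply/memP; exists t.
  by rewrite /a; lia.
have step t : (t < k)%N -> a t = (a t.+1).+1 \/ a t.+1 = (a t).+1.
  by move=> tk; have := gst t tk; rewrite !gE// 1?ltnW//; lia.
have ak t : (t <= k)%N -> (a t < k.+1)%N.
  move=> tk; rewrite ltnS.
  have -> : k = (a s + k)%N by rewrite /a gs.
  by apply: unit_steps_close => // j /step; lia.
pose h : k.+1.-tuple 'I_k.+1 := [tuple inord (a t) | t < k.+1].
have hE t : (t <= k)%N -> depth h t = a t.
  move=> tk; have tk' : (t < k.+1)%N by [].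
  by rewrite /depth -(tnth_nth ord0 h (Ordinal tk')) tnth_mktuple inordK// ak.
exists h => /=.
  apply/andP; split; [apply/and3P; split|].
  - by rewrite !hE// /a g0k.
  - apply/forallP => t; rewrite !hE//; last exact: ltnW.
    by have := step t (ltn_ord t); rewrite /unit_step; lia.
  - by apply/existsP; exists (Ordinal (sk : s < k.+1)%N); rewrite hE// /a gs.
  - apply/forallP => t; rewrite !hE//; last exact: ltnW.
    by have := step t (ltn_ord t); lia.
apply: eq_from_tnth => t; rewrite !(tnth_nth 0) path_of_depthsE.
by rewrite hE ?gE.
Qed.

Section Crossings.
Context (r : nat) (c : k.-tuple 'I_r).

(** The data that determine the matrix entry met by a step, up to the level N:
    whether the entry is diagonal, the color, and the larger depth at the ends
    of the step. *)
Definition step_key h (t : 'I_k) : bool * 'I_r * 'I_k.+1 :=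
  (depth h t == depth h t.+1, tnth c t,
   if (depth h t <= depth h t.+1)%N then nth ord0 h t.+1 else nth ord0 h t).

Lemma step_key_depth h t :
  (step_key h t).2 = maxn (depth h t) (depth h t.+1) :> nat.
Proof. by rewrite /step_key /depth /=; case: leqP. Qed.

Definition key_count h (q : bool * 'I_r * 'I_k.+1) : nat :=
  #|[pred t : 'I_k | step_key h t == q]|.

(** A step between depths e - 1 and e joins the heights -e and -e + 1. *)
Lemma crossings_path_of_depths h u (e : 'I_k.+1) : is_shape h -> is_strict h ->
  crossings c u (- (e : nat)%:Z) (path_of_depths h) = key_count h (false, u, e).
Proof.
move=> /and3P[_ /forallP hst _] /forallP hne.
apply: eq_card => t; rewrite !inE !path_of_depthsE.
rewrite -pair_eqE /= -pair_eqE /= (negbTE (hne t)) /=; congr (_ && _).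
have -> : (step_key h t).2 == e = (maxn (depth h t) (depth h t.+1) == e :> nat).
  by rewrite -val_eqE /= step_key_depth.
have := hst t; have := hne t.
move: (depth h t) (depth h t.+1) => a b.
rewrite /unit_step /= => /eqP ab /andP[ab1 ab2].
apply/eqP/eqP => [E|].
  have : - a%:Z \in [fset - e%:Z; (- e%:Z + 1)%R]%fset by rewrite -E !inE eqxx.
  have : - b%:Z \in [fset - e%:Z; (- e%:Z + 1)%R]%fset by rewrite -E !inE eqxx orbT.
  rewrite !inE => /orP[]/eqP h1 /orP[]/eqP h2; lia.
move=> E; have [[-> ->]|[-> ->]] : (- a%:Z = - e%:Z /\ - b%:Z = - e%:Z + 1) \/
    (- a%:Z = - e%:Z + 1 /\ - b%:Z = - e%:Z) by lia.
  by [].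
by rewrite fsetUC.
Qed.

Lemma crossings_out h u (i : int) :
  (forall e : 'I_k.+1, i <> - (e : nat)%:Z) ->
  crossings c u i (path_of_depths h) = 0%N.
Proof.
move=> iN; apply: eq_card0 => t; rewrite !inE !path_of_depthsE.
apply/negP => /andP[_ /eqP E].
have : i \in [fset - (depth h t)%:Z; - (depth h t.+1)%:Z]%fset.
  by rewrite E !inE eqxx.
by rewrite !inE => /orP[]/eqP; exact: iN.
Qed.

(** Shapes with a zero step contribute 0: such a step has a diagonal key, whose
    factor vanishes when the key occurs.  For the others only the keys of the
    crossed lines remain. *)
Lemma sum_Gamma (R : realType) (m : 'I_r -> nat -> R) : (forall u, m u 0%N = 1) ->
  \sum_(gamma \in Gamma k)
    \prod_(u < r) \big[*%R/1]_(i \in [set: int]) m u (crossings c u i gamma) =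
  \sum_(h | is_shape h) \prod_(q : bool * 'I_r * 'I_k.+1)
    (if q.1.1 then (key_count h q == 0%N)%:R else m q.1.2 (key_count h q)).
Proof.
move=> m0.
rewrite (@reindex_fsbig _ _ _ _ _ path_of_depths _ _ _ Gamma_path_of_depths).
rewrite -(@bigfs _ _ _ _ (index_enum _) [pred h | is_shape h && is_strict h])
  ?index_enum_uniq//; last by move=> h _; rewrite mem_index_enum.
rewrite [RHS](bigID is_strict)/= [X in _ = _ + X]big1 ?addr0; last first.
  move=> h /andP[_]; rewrite negb_forall => /existsP[t /negPn ht].
  rewrite (bigD1 (step_key h t))//= ht.
  have -> : (key_count h (step_key h t) == 0%N) = false.
    by apply/negbTE/pred0Pn; exists t; rewrite /= eqxx.
  by rewrite mul0r.
apply: eq_bigr => h /andP[hs hst].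
have flat0 u e : key_count h (true, u, e) = 0%N.
  apply: eq_card0 => t; rewrite !inE; apply/eqP => -[ht _ _].
  by have := forallP hst t; rewrite ht.
transitivity (\prod_(f : bool) \prod_(u < r) \prod_(e < k.+1)
    (if f then (key_count h (f, u, e) == 0%N)%:R else m u (key_count h (f, u, e)))).
  rewrite big_bool /= [X in _ = X * _]big1 ?mul1r; last first.
    by move=> u _; rewrite big1// => e _; rewrite flat0 eqxx.
  apply: eq_bigr => u _.
  pose s := [seq - (e : nat)%:Z | e : 'I_k.+1 <- enum 'I_k.+1].
  rewrite (@fsbigE _ _ _ _ _ s)//.
  - rewrite /s big_map big_enum_cond /=; apply: eq_big => [e|e _].
      by rewrite in_setT.
    by rewrite crossings_path_of_depths.
  - rewrite map_inj_uniq ?enum_uniq// => e e' /eqP.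
    by rewrite eqr_opp eqz_nat => /eqP/val_inj.
  - move=> i _ iNs; rewrite crossings_out// => e ie.
    by move/negP: iNs; apply; apply/mapP; exists e; rewrite ?mem_enum.
by rewrite pair_bigA /= pair_bigA /=; apply: eq_bigr => -[[f u] e] _.
Qed.
End Crossings.
End GammaShapes.

(** * The trace of a product of tridiagonal matrices *)

(** In the walk of level N, a step whose larger depth is e meets the variable of
    index N - e, diagonal ones being on the left of the sum type. *)
Definition key_index (r k N : nat) (q : bool * 'I_r * 'I_k.+1) :
    ('I_r * nat) + ('I_r * nat) :=
  (if q.1.1 then inl else inr) (q.1.2, (N - q.2)%N).

Lemma prod_powRN (R : realType) (I : Type) (s : seq I) (alpha : I -> R) (x : R) :
  0 < x ->
  \prod_(u <- s) x `^ (- alpha u) = x `^ (- (\sum_(u <- s) alpha u)).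
Proof.
move=> x0; elim: s => [|u s IH]; first by rewrite !big_nil oppr0 powRr0.
by rewrite !big_cons IH opprD powRD// (gt_eqF x0) implybT.
Qed.

(** Here i.+1 is the level n.+1 - p of a walk with minimal row p, and the walk
    stays inside the matrix exactly when no depth exceeds i. *)
Lemma ntr_prod_normalized_tridiag (R : realType) (r k : nat) (c : k.-tuple 'I_r)
    (alpha : 'I_r -> R) (V : ('I_r * nat) + ('I_r * nat) -> R) (n : nat) :
  ntr (\prod_(u <- c) normalized_tridiag (alpha u) (fun j => V (inl (u, j)))
    (fun j => V (inr (u, j))) n.+1) =
  n.+1%:R^-1 * n.+1%:R `^ (- (\sum_(u <- c) alpha u)) *
  \sum_(h : k.+1.-tuple 'I_k.+1 | is_shape h)
    \sum_(i < n.+1 | [forall t : 'I_k.+1, (depth h t <= i)%N])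
      \prod_(t < k) V (key_index i.+1 (step_key c h t)).
Proof.
rewrite /ntr -mulrA; congr (_ * _).
rewrite /normalized_tridiag (@scaler_prod R 'M[R]_n.+1).
rewrite prod_powRN ?ltr0n// mxtraceZ; congr (_ * _).
rewrite big_tuple (trace_prodmx ord0).
pose E (t : 'I_k) (a b : nat) := let u := tnth c t in
  if a == b then V (inl (u, (n.+1 - a)%N))
  else if b == a.+1 then V (inr (u, (n.+1 - b)%N))
  else if a == b.+1 then V (inr (u, (n.+1 - a)%N)) else 0.
transitivity (\sum_(f : k.+1.-tuple 'I_n.+1 | nth ord0 f 0 == nth ord0 f k)
    \prod_(t < k) E t (nth ord0 f t) (nth ord0 f t.+1)).
  by apply: eq_bigr => f _; apply: eq_bigr => t _; rewrite mxE.
rewrite sum_closed_walks; last first.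
  move=> t a b; rewrite /unit_step /E.
  case: eqP => [->|_]; first by rewrite !leqnSn.
  case: eqP => [->|_]; first by rewrite leqnn !leqW.
  by case: eqP => [->|_]; first by rewrite leqnn !leqW.
apply: eq_bigr => h /and3P[_ /forallP hst _].
(* From the minimal row p to the level n.+1 - p = i.+1. *)
rewrite (reindex_inj rev_ord_inj) /=.
apply: eq_big => [i|i /forallP hi].
  by apply: eq_forallb => t; have := ltn_ord i; lia.
apply: eq_bigr => t _.
have := hst t; have := step_key_depth c h t.
rewrite /key_index /E /=.
have hi0 : (n.+1 - i.+1 + depth h t < n.+1)%N.
  by have := hi (widen_ord (leqnSn k) t); rewrite /=.
have hi1 : (n.+1 - i.+1 + depth h t.+1 < n.+1)%N := hi (lift ord0 t).
move: (depth h t) (depth h t.+1) hi0 hi1 => a b hi0 hi1.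
rewrite eqn_add2l -addnS -[(n.+1 - i.+1 + b).+1]addnS !eqn_add2l /unit_step.
have ik := ltn_ord i.
case: eqP => [-> -> _|ab ->]; first by congr (V (inl (_, _))); lia.
case: eqP => [-> _|ba]; first by congr (V (inr (_, _))); lia.
case: eqP => [-> _|ab2]; first by congr (V (inr (_, _))); lia.
by move=> /andP[]; lia.
Qed.

(** * Elementary limits *)

Lemma cvg_prod_fin (R : realType) (I : finType) (f : I -> nat -> R) (l : I -> R) :
  (forall i, f i n @[n --> \oo] --> l i) ->
  \prod_i f i n @[n --> \oo] --> \prod_i l i.
Proof.
move=> fl; elim: (index_enum I) => [|i s IH].
  by under eq_fun do rewrite big_nil; rewrite big_nil; exact: cvg_cst.
under eq_fun do rewrite big_cons; rewrite big_cons; exact: cvgM.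
Qed.

Lemma cvg_sum_fin (R : realType) (I : finType) (Q : pred I) (f : I -> nat -> R)
    (l : I -> R) :
  (forall i, Q i -> f i n @[n --> \oo] --> l i) ->
  \sum_(i | Q i) f i n @[n --> \oo] --> \sum_(i | Q i) l i.
Proof.
move=> fl; elim: (index_enum I) => [|i s IH].
  by under eq_fun do rewrite big_nil; rewrite big_nil; exact: cvg_cst.
under eq_fun do rewrite big_cons; rewrite big_cons.
by case: ifPn => // Qi; apply: cvgD => //; exact: fl.
Qed.

Lemma cvg_natr_powRN (R : realType) (p : R) : 0 < p ->
  n%:R `^ (- p) @[n --> \oo] --> (0 : R).
Proof.
move=> p0; apply/cvgrPdist_le => e e0; near=> n.
have n0 : 0 < n%:R :> R by rewrite ltr0n; near: n; exists 1%N.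
rewrite sub0r normrN ger0_norm ?powR_ge0// powRN invf_ple ?posrE ?powR_gt0//.
have -> : e^-1 = (e^-1 `^ p^-1) `^ p.
  by rewrite -powRrM mulVf ?gt_eqF// powRr1// invr_ge0 ltW.
apply: ge0_ler_powR; rewrite ?nnegrE ?powR_ge0 ?ltW//.
near: n; exact: nbhs_infty_gtr.
Unshelve. all: by end_near. Qed.

Lemma cvg_shift_ratio_powR (R : realType) (e : nat) (p : R) :
  ((n - e)%N%:R / n%:R) `^ p @[n --> \oo] --> (1 : R).
Proof.
have h : (n - e)%N%:R / n%:R @[n --> \oo] --> (1 : R).
  have : 1 - e%:R * n%:R `^ (- 1) @[n --> \oo] --> (1 - e%:R * 0 : R).
    apply: cvgB; first exact: cvg_cst.
    by apply: cvgM; [exact: cvg_cst|exact: cvg_natr_powRN].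
  rewrite mulr0 subr0; apply: cvg_trans; apply: near_eq_cvg; near=> n.
  have n0 : 0 < n%:R :> R by rewrite ltr0n; near: n; exists 1%N.
  have en : (e <= n)%N by near: n; exists e.
  by rewrite /= powR_inv1 ?ltW// natrB// mulrBl divff ?gt_eqF.
have c : {for (1 : R), continuous (fun x : R => x `^ p)}.
  apply: differentiable_continuous; apply/derivable1_diffP.
  by have [] := @is_derive1_powR R p 1 ltr01.
by have := cvg_comp _ _ h c; rewrite powR1.
Unshelve. all: by end_near. Qed.

(** * Moments and means of the walk weights *)

Section TracialMoments.
Context (disp : measure_display) (T : measurableType disp) (R : realType)
  (P : probability T R) (r : nat) (d b : 'I_r -> nat -> {RV P >-> R})
  (alpha : 'I_r -> R) (m : 'I_r -> nat -> R).
Hypothesis alpha_gt0 : forall u, 0 < alpha u.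
Hypothesis d_moments : forall u n, (1 <= n)%N -> finite_moments (d u n).
Hypothesis b_moments : forall u n, (1 <= n)%N -> finite_moments (b u n).
Hypothesis b_lim : forall u (k : nat),
  'E_P[fun w => ((b u n w / n%:R `^ alpha u) ^+ k)%R]%E @[n --> \oo]
    --> (m u k)%:E.
Hypothesis d_bound : forall u (k : nat),
  (ereal_sup [set 'E_P[fun w => (`|d u n w| ^+ k)%R] | n in [set n | (1 <= n)%N]]
    < +oo)%E.
Hypothesis indep : independent_RVs (@entries_index 'I_r) (entries d b).
Context (k : nat).
Local Notation key := (bool * 'I_r * 'I_k.+1)%type.
Local Notation V := (entries d b).

Lemma entries_moments x : entries_index x -> finite_moments (V x).
Proof. by case: x => [] [u n] /= n0; [exact: d_moments|exact: b_moments]. Qed.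

Lemma diagonal_moment_bound u e : exists C, forall n, (1 <= n)%N ->
  `|\int[P]_w (d u n w ^+ e)| <= C.
Proof.
pose S := (ereal_sup
  [set 'E_P[fun w => (`|d u n w| ^+ e)%R] | n in [set n | (1 <= n)%N]])%E.
exists (fine S) => n n1; have di := d_moments u n1 e.
have absi : P.-integrable setT (fun w => (`|d u n w| ^+ e)%:E).
  by under eq_fun do rewrite -normrX; exact: integrable_norm.
apply: le_trans (le_normr_Rintegral _ _) _ => //.
under eq_Rintegral do rewrite normrX.
have ES : ((\int[P]_w (`|d u n w| ^+ e))%:E <= S)%E.
  rewrite -EFin_Rintegral//; apply: ereal_sup_ubound.
  by exists n => //; rewrite unlock.
have Sfin : S \is a fin_num.
  by rewrite fin_numElt d_bound andbT (lt_le_trans _ ES)// ltNyr.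
by rewrite -lee_fin [leRHS]fineK.
Qed.

(** The limit of the moment of order e of the entry with key q at level N, divided
    by N to the power e times the exponent of its color. *)
Definition limit_moment (q : key) (e : nat) : R :=
  if q.1.1 then (e == 0%N)%:R else m q.1.2 e.

(** The off-diagonal moments are normalized by the power of their own index
    N - e, and (N - e) / N tends to 1.  The diagonal moments are bounded, so a
    positive power of N in the denominator makes them vanish, whereas the moment
    of order 0 is 1. *)
Lemma cvg_entry_moment (q : key) (e : nat) :
  N%:R `^ (- (alpha q.1.2 * e%:R)) * \int[P]_w (V (key_index N q) w ^+ e)
    @[N --> \oo] --> limit_moment q e.
Proof.
case: q => -[[] u] dl; rewrite /limit_moment /key_index /=; last first.
  have bl : \int[P]_w ((b u n w / n%:R `^ alpha u) ^+ e) @[n --> \oo] --> m u e.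
    have /fine_cvg := @b_lim u e.
    by apply: cvg_trans; apply: near_eq_cvg; near=> n => /=; rewrite unlock.
  have bl' : \int[P]_w ((b u (n - dl)%N w / (n - dl)%N%:R `^ alpha u) ^+ e)
      @[n --> \oo] --> m u e.
    by have := cvg_comp _ _ (@cvg_subnr dl) bl; apply.
  rewrite -(mul1r (m u e)).
  have h := cvgM (@cvg_shift_ratio_powR R dl (alpha u * e%:R)) bl'.
  apply: cvg_trans (h _); apply: near_eq_cvg; near=> n => /=.
  have n0 : 0 < n%:R :> R by rewrite ltr0n; near: n; exists 1%N.
  have nd0 : (0 < n - dl)%N by rewrite subn_gt0; near: n; exists dl.+1.
  have nd : 0 < (n - dl)%N%:R :> R by rewrite ltr0n.
  have E1 : ((n - dl)%N%:R / n%:R) `^ (alpha u * e%:R) =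
      (n - dl)%N%:R `^ (alpha u * e%:R) * n%:R `^ (- (alpha u * e%:R)).
    rewrite powRM ?invr_ge0 ?ltW//; congr (_ * _).
    by rewrite -powR_inv1 ?ltW// -powRrM mulN1r.
  have E2 w : (b u (n - dl)%N w / (n - dl)%N%:R `^ alpha u) ^+ e =
      b u (n - dl)%N w ^+ e * ((n - dl)%N%:R `^ (alpha u * e%:R))^-1.
    by rewrite exprMn exprVn powRrM powR_mulrn ?powR_ge0.
  under eq_Rintegral do rewrite E2.
  rewrite RintegralZr//; last exact: b_moments.
  by rewrite E1; field; rewrite gt_eqF ?powR_gt0.
have [->|e0] := posnP e.
  rewrite mulr0 oppr0.
  under eq_fun do rewrite powRr0 mul1r.
  have E n : \int[P]_w (d u (n - dl)%N w ^+ 0) = 1.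
    by rewrite -[RHS](Rintegral_cst_probability P).
  by under eq_fun do rewrite E; exact: cvg_cst.
rewrite mulr0n; have [C hC] := diagonal_moment_bound u e.
have p0 : 0 < alpha u * e%:R by rewrite mulr_gt0 ?ltr0n.
have h : n%:R `^ (- (alpha u * e%:R)) * C @[n --> \oo] --> (0 : R).
  rewrite -(mul0r C); apply: cvgM; last exact: cvg_cst.
  exact: cvg_natr_powRN.
have hN : - (n%:R `^ (- (alpha u * e%:R)) * C) @[n --> \oo] --> (0 : R).
  by rewrite -oppr0; exact: cvgN.
apply: (squeeze_cvgr _ hN h).
near=> n; rewrite -ler_norml normrM ger0_norm ?powR_ge0//.
by rewrite ler_wpM2l ?powR_ge0// hC// subn_gt0; near: n; exists dl.+1.
Unshelve. all: by end_near. Qed.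

Lemma entries_index_key_index (N : nat) (q : key) : (q.2 < N)%N ->
  entries_index (key_index N q).
Proof. by case: q => -[[] u] e /= eN; rewrite subn_gt0. Qed.

(** Distinct keys at one level give distinct variables; for N <= k the truncated
    subtraction could identify them. *)
Lemma key_index_inj (N : nat) : (k < N)%N -> injective (@key_index r k N).
Proof.
move=> kN [[f u] e] [[f' u'] e'].
have sub_inj : (N - e)%N = (N - e')%N -> e = e'.
  by move=> h; apply: val_inj => /=; have := ltn_ord e; have := ltn_ord e'; lia.
by case: f; case: f' => //= -[-> /sub_inj ->].
Qed.

Lemma key_index_far (N N' : nat) (q q' : key) : (N + k < N')%N ->
  key_index N q <> key_index N' q'.
Proof.
move=> NN'; have := ltn_ord q'.2.
by case: q q' => -[[] u] e [[[] u'] e'] //= ? []; lia.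
Qed.

Lemma sub_entries_index (N : nat) (l : seq key) :
  {in l, forall q : key, (q.2 < N)%N} ->
  [set` [seq key_index N q | q <- l]] `<=` @entries_index 'I_r.
Proof.
by move=> lN x /= /mapP[q ql ->]; apply: entries_index_key_index; exact: lN.
Qed.

(** Stated for any list of keys, since it serves both for the weight of a walk and
    for its square. *)
Lemma cvg_monomial_moment (l : seq key) :
  N%:R `^ (- (\sum_(q <- l) alpha q.1.2)) *
    \int[P]_w (\prod_(q <- l) V (key_index N q) w) @[N --> \oo] -->
  \prod_(q : key) limit_moment q (count_mem q l).
Proof.
have h := cvg_prod_fin (fun q => @cvg_entry_moment q (count_mem q l)).
apply: cvg_trans h; apply: near_eq_cvg; near=> N.
have kN : (k < N)%N by near: N; exists k.+1.
have N0 : 0 < N%:R :> R by rewrite ltr0n (leq_trans _ kN).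
pose Q := [seq key_index N q | q <- index_enum key].
have QD : [set` Q] `<=` @entries_index 'I_r.
  by apply: sub_entries_index => q _; apply: leq_trans (ltn_ord _) kN.
have uQ : uniq Q by rewrite map_inj_uniq ?index_enum_uniq//; exact: key_index_inj.
have -> : \int[P]_w (\prod_(q <- l) V (key_index N q) w) =
    \int[P]_w (\prod_(x <- [seq key_index N q | q <- l]) V x w).
  by under [RHS]eq_Rintegral do rewrite big_map.
rewrite (Rintegral_monomial indep entries_moments uQ) //; last first.
  by move=> x /mapP[q _ ->]; rewrite map_f// mem_index_enum.
rewrite -prod_powRN// big_map
  (prod_count_exp (fun q : key => N%:R `^ (- alpha q.1.2))
    (index_enum_uniq key)); last first.
  by move=> q _; rewrite mem_index_enum.
rewrite -big_split /=; apply: eq_bigr => q _.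
rewrite -mulNr powRrM powR_mulrn ?powR_ge0//; congr (_ * _).
suff -> : count_mem (key_index N q) [seq key_index N q | q <- l] = count_mem q l.
  by [].
rewrite count_map; apply: eq_count => q' /=.
by rewrite (inj_eq (key_index_inj kN)).
Unshelve. all: by end_near. Qed.

Section Shape.
Context (c : k.-tuple 'I_r) (h : k.+1.-tuple 'I_k.+1).

Definition steps : seq key := [seq step_key c h t | t <- enum 'I_k].

Lemma sum_steps : \sum_(q <- steps) alpha q.1.2 = \sum_(u <- c) alpha u.
Proof. by rewrite big_map big_enum /= big_tuple. Qed.

Lemma prod_steps (F : key -> R) :
  \prod_(q <- steps) F q = \prod_(t < k) F (step_key c h t).
Proof. by rewrite big_map big_enum. Qed.

Lemma count_steps q : count_mem q steps = key_count c h q.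
Proof.
by rewrite -sum1_count big_map big_enum_cond /key_count -sum1_card.
Qed.

(** The walks of level i.+1 and shape h stay within the indices at least 1. *)
Definition fits (i : nat) : bool := [forall t : 'I_k.+1, (depth h t <= i)%N].

Lemma fits_steps i : fits i -> {in steps, forall q : key, (q.2 < i.+1)%N}.
Proof.
move=> /forallP hi q /mapP[t _ ->]; rewrite step_key_depth ltnS geq_max.
exact/andP/(conj (hi (widen_ord (leqnSn k) t)) (hi (lift ord0 t))).
Qed.

Lemma fits_large i : (k <= i)%N -> fits i.
Proof.
move=> ki; apply/forallP => t; apply: leq_trans ki.
by rewrite -ltnS; exact: ltn_ord.
Qed.

(** The value 0 at the levels that do not fit makes the trace a sum over all
    levels at most n. *)
Definition normalized_weight (i : nat) (w : T) : R :=
  if fits i then i.+1%:R `^ (- (\sum_(u <- c) alpha u)) *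
    \prod_(q <- steps) V (key_index i.+1 q) w
  else 0.

Local Notation Y := normalized_weight.

Lemma integrable_steps i (l : seq key) : {in l, forall q : key, (q.2 < i)%N} ->
  P.-integrable setT (fun w => (\prod_(q <- l) V (key_index i q) w)%:E).
Proof.
move=> li; have := integrable_monomial indep entries_moments (sub_entries_index li).
by under eq_fun do rewrite big_map.
Qed.

(** The square of a weight is the weight of the doubled list of steps. *)
Lemma sqr_normalized_weight i w : Y i w ^+ 2 =
  if fits i then i.+1%:R `^ (- (\sum_(q <- steps ++ steps) alpha q.1.2)) *
    \prod_(q <- steps ++ steps) V (key_index i.+1 q) w
  else 0.
Proof.
rewrite /Y; case: ifP => _; last by rewrite expr0n.
rewrite !big_cat /= sum_steps opprD powRD; last first.
  by rewrite pnatr_eq0 implybT.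
by rewrite expr2 mulrACA.
Qed.

Lemma square_integrable_normalized_weight i : square_integrable P (Y i).
Proof.
have [hi|/negbTE hi] := boolP (fits i); last first.
  by rewrite /Y hi; exact: square_integrable_cst.
split; last first.
  under eq_fun do rewrite sqr_normalized_weight hi.
  apply: integrable_realZ; apply: integrable_steps => q.
  by rewrite mem_cat orbb; exact: fits_steps.
rewrite /Y hi; apply: measurable_funM => //; apply/measurable_EFinP.
by apply: (measurable_int P); apply: integrable_steps; exact: fits_steps.
Qed.

Lemma Rintegral_normalized_weight i : fits i ->
  \int[P]_w Y i w = i.+1%:R `^ (- (\sum_(q <- steps) alpha q.1.2)) *
    \int[P]_w (\prod_(q <- steps) V (key_index i.+1 q) w).
Proof.
move=> hi; rewrite /Y hi sum_steps RintegralZl//.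
by apply: integrable_steps; exact: fits_steps.
Qed.

Lemma cvg_normalized_weight :
  \int[P]_w Y i w @[i --> \oo] --> \prod_(q : key) limit_moment q (key_count c h q).
Proof.
rewrite (eq_bigr (fun q => limit_moment q (count_mem q steps))); last first.
  by move=> q _; rewrite count_steps.
have := @cvg_monomial_moment steps.
rewrite -cvg_shiftS; apply: cvg_trans; apply: near_eq_cvg; near=> i => /=.
rewrite Rintegral_normalized_weight// fits_large//.
by near: i; exists k.
Unshelve. all: by end_near. Qed.

(** The second moments converge, by the moment limit for the doubled list of
    steps. *)
Lemma bounded_sqr_normalized_weight :
  exists C, forall i, \int[P]_w (Y i w ^+ 2) <= C.
Proof.
have : cvgn (fun i => \int[P]_w (Y i w ^+ 2)).
  apply/cvg_ex.
  exists (\prod_(q : key) limit_moment q (count_mem q (steps ++ steps))).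
  have := @cvg_monomial_moment (steps ++ steps).
  rewrite -cvg_shiftS; apply: cvg_trans; apply: near_eq_cvg; near=> i => /=.
  have hi : fits i by rewrite fits_large//; near: i; exists k.
  under [X in _ = X]eq_Rintegral do rewrite sqr_normalized_weight hi.
  rewrite RintegralZl//; apply: integrable_steps => q.
  by rewrite mem_cat orbb; exact: fits_steps.
move=> /cvg_seq_bounded/bounded_fun_has_ubound[C HC]; exists C => i.
by apply: HC; exists i.
Unshelve. all: by end_near. Qed.

(** The two weights involve the variables of disjoint ranges of indices. *)
Lemma uncorrelated_normalized_weight i j : (i + k < j)%N ->
  \int[P]_w (Y i w * Y j w) = \int[P]_w Y i w * \int[P]_w Y j w.
Proof.
move=> ij; have [hi|hi] := boolP (fits i); last first.
  have Y0 w : Y i w = 0 by rewrite /Y (negbTE hi).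
  under eq_Rintegral do rewrite Y0 mul0r.
  under [X in _ = X * _]eq_Rintegral do rewrite Y0.
  by rewrite !Rintegral_cst_probability mul0r.
have hj : fits j by rewrite fits_large//; lia.
have sD i' : fits i' ->
    [set` [seq key_index i'.+1 q | q <- steps]] `<=` @entries_index 'I_r.
  by move=> hi'; apply: sub_entries_index; exact: fits_steps.
have E w : Y i w * Y j w =
   (i.+1%:R `^ (- (\sum_(q <- steps) alpha q.1.2)) *
    j.+1%:R `^ (- (\sum_(q <- steps) alpha q.1.2))) *
   (\prod_(x <- [seq key_index i.+1 q | q <- steps]) V x w *
    \prod_(x <- [seq key_index j.+1 q | q <- steps]) V x w).
  by rewrite /Y hi hj !sum_steps !big_map mulrACA.
have sub2 : [set` [seq key_index i.+1 q | q <- steps] ++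
    [seq key_index j.+1 q | q <- steps]] `<=` @entries_index 'I_r.
  by move=> x /=; rewrite mem_cat => /orP[]; exact: sD.
under eq_Rintegral do rewrite E.
rewrite RintegralZl//; last first.
  have := integrable_monomial indep entries_moments sub2.
  by under eq_fun do rewrite big_cat.
rewrite (Rintegral_monomialM indep entries_moments sub2); last first.
  apply/hasPn => x /mapP[q _ ->]; apply/mapP => -[q' _ /esym].
  by apply: key_index_far; lia.
rewrite !Rintegral_normalized_weight// mulrACA.
by congr (_ * _ * (_ * _)); apply: eq_Rintegral => w _; rewrite big_map.
Qed.

Lemma ae_cvg_mean_normalized_weight :
  {ae P, forall w, n%:R^-1 * (\sum_(i < n) Y i w) @[n --> \oo] -->
    \prod_(q : key) limit_moment q (key_count c h q)}.
Proof.
have [C hC] := bounded_sqr_normalized_weight.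
exact: (strong_law square_integrable_normalized_weight hC
  uncorrelated_normalized_weight cvg_normalized_weight).
Qed.

End Shape.

End TracialMoments.

(** * The limit of the normalized traces *)

Lemma cvg_sum_weighted_mean (R : realType) (I : finType) (Q : pred I) (A : R)
    (y : I -> nat -> R) (l : I -> R) : 0 < A ->
  (forall h, Q h -> n%:R^-1 * (\sum_(i < n) y h i) @[n --> \oo] --> l h) ->
  n%:R^-1 * n%:R `^ (- A) *
    (\sum_(h | Q h) \sum_(i < n) i.+1%:R `^ A * y h i) @[n --> \oo] -->
  (A + 1)^-1 * \sum_(h | Q h) l h.
Proof.
move=> A0 yl; under eq_fun do rewrite mulr_sumr; rewrite mulr_sumr.
by apply: cvg_sum_fin => h /yl; exact: cvg_weighted_mean.
Qed.

Theorem theorem4 (disp : measure_display) (T : measurableType disp)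
    (R : realType) (P : probability T R) (r : nat) (hr : (1 <= r)%N)
    (d b : 'I_r -> nat -> {RV P >-> R}) (alpha : 'I_r -> R)
    (m : 'I_r -> nat -> R)
    (alpha_gt0 : forall u, 0 < alpha u)
    (d_moments : forall u n, (1 <= n)%N -> finite_moments (d u n))
    (b_moments : forall u n, (1 <= n)%N -> finite_moments (b u n))
    (m0 : forall u, m u 0%N = 1)
    (b_lim : forall u (k : nat),
      'E_P[fun w => ((b u n w / n%:R `^ alpha u) ^+ k)%R]%E @[n --> \oo]
        --> (m u k)%:E)
    (d_bound : forall u (k : nat),
      (ereal_sup [set 'E_P[fun w => (`|d u n w| ^+ k)%R] | n in [set n | (1 <= n)%N]]
        < +oo)%E)
    (indep : independent_RVs (@entries_index 'I_r) (entries d b))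
    (k : nat) (hk : (1 <= k)%N) (c : k.-tuple 'I_r) :
  let X (u : 'I_r) (n : nat) (w : T) : 'M[R]_n :=
    normalized_tridiag (alpha u) (fun j => d u j w) (fun j => b u j w) n in
  let trX (n : nat) (w : T) : R := ntr (\prod_(u <- c) X u n w) in
  let limit : R :=
    (\sum_(u <- c) alpha u + 1)^-1 *
    \sum_(gamma \in Gamma k)
      \prod_(u < r) \big[*%R/1]_(i \in [set: int]) m u (crossings c u i gamma) in
  ('E_P[trX n]%E @[n --> \oo] --> limit%:E) /\
  {ae P, forall w, trX n w @[n --> \oo] --> limit}.
Proof.
move=> X trX limit.
pose A := \sum_(u <- c) alpha u.
pose Y := normalized_weight d b alpha c.
have A0 : 0 < A.
  rewrite /A; case: k hk c {limit trX Y A} => // k' _ c.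
  rewrite (tuple_eta c) big_cons ltr_wpDr// sumr_ge0// => u _.
  exact: ltW.
have limitE : limit = (A + 1)^-1 * \sum_(h : k.+1.-tuple 'I_k.+1 | is_shape h)
    \prod_(q : bool * 'I_r * 'I_k.+1) limit_moment m q (key_count c h q).
  by rewrite /limit sum_Gamma.
have trE n w : trX n.+1 w = n.+1%:R^-1 * n.+1%:R `^ (- A) *
    \sum_(h : k.+1.-tuple 'I_k.+1 | is_shape h)
      \sum_(i < n.+1) i.+1%:R `^ A * Y h i w.
  rewrite /trX; have -> := @ntr_prod_normalized_tridiag R r k c alpha
    (fun x => entries d b x w) n.
  congr (_ * _); apply: eq_bigr => h _; rewrite big_mkcond /=.
  apply: eq_bigr => i _; rewrite /Y /normalized_weight /fits.
  case: ifP => _; last by rewrite mulr0.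
  rewrite prod_steps powRN -/A mulVKf// gt_eqF// powR_gt0//.
have Y2 h i : square_integrable P (Y h i).
  exact: square_integrable_normalized_weight.
have wYi n (h : k.+1.-tuple 'I_k.+1) (i : 'I_n) :
    P.-integrable setT (EFin \o (fun w => i.+1%:R `^ A * Y h i w)).
  by apply: integrable_realZ; exact: square_integrable_integrable.
(* By linearity the expectations have the same form as the traces, with the
   expectations of the weights in place of the weights. *)
have ExpE n : 'E_P[trX n.+1]%E = (n.+1%:R^-1 * n.+1%:R `^ (- A) *
    \sum_(h : k.+1.-tuple 'I_k.+1 | is_shape h)
      \sum_(i < n.+1) i.+1%:R `^ A * \int[P]_w Y h i w)%:E.
  pose S h w := \sum_(i < n.+1) i.+1%:R `^ A * Y h i w.
  have [iS ES] : (forall h, P.-integrable setT (EFin \o S h)) /\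
      (forall h, \int[P]_w S h w =
        \sum_(i < n.+1) i.+1%:R `^ A * \int[P]_w Y h i w).
    split=> h; have [iS ES] := Rintegral_sum (index_enum 'I_n.+1) (wYi n.+1 h) => //.
    rewrite ES; apply: eq_bigr => i _; rewrite RintegralZl//.
    exact: square_integrable_integrable.
  have [iSS ESS] := Rintegral_sum
    [seq h <- index_enum {: k.+1.-tuple 'I_k.+1} | is_shape h] iS.
  rewrite unlock; under eq_integral do rewrite trE -big_filter.
  rewrite EFin_Rintegral; last exact: integrable_realZ.
  rewrite RintegralZl// ESS big_filter.
  by congr ((_ * _)%:E); apply: eq_bigr => h _; rewrite ES.
split.
  rewrite -cvg_shiftS; under eq_fun do rewrite ExpE.
  apply: cvg_EFin; first exact: nearW.
  rewrite limitE.
  have := @cvg_sum_weighted_mean R _ (@is_shape k) A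
    (fun h i => \int[P]_w Y h i w) _ A0 (fun h _ => cvg_mean
      (@cvg_normalized_weight _ _ _ P r d b alpha m alpha_gt0 d_moments
        b_moments b_lim d_bound indep k c h)).
  by rewrite -cvg_shiftS.
have : {ae P, forall w, forall h : k.+1.-tuple 'I_k.+1,
    n%:R^-1 * (\sum_(i < n) Y h i w) @[n --> \oo] -->
    \prod_(q : bool * 'I_r * 'I_k.+1) limit_moment m q (key_count c h q)}.
  apply: filter_forall => h.
  exact: ae_cvg_mean_normalized_weight.
apply: filterS => w Yw; rewrite -cvg_shiftS; under eq_fun do rewrite trE.
have := cvg_sum_weighted_mean (Q := @is_shape k)
  (y := fun h i => Y h i w) A0 (fun h _ => Yw h).
by rewrite -cvg_shiftS limitE.
Qed.
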